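(* The simultaneous identification capacity of the noiseless qubit channel $\mathrm{id}_2$ (the identity channel on $\mathbb{C}^2$) is $C_{\rm ID}^{\rm sim}(\mathrm{id}_2)=1$, whereas its unrestricted identification capacity is $C_{\rm ID}(\mathrm{id}_2)=2$. More generally, for a quantum channel (CPTP map) $\mathcal{N}:A\to B$ between finite-dimensional Hilbert spaces, $C_{\rm ID}^{\rm sim}(\mathcal{N})\le\log\min\{|A|,|B|\}$, and this is a strong converse bound: for all $\lambda_1,\lambda_2>0$ with $\lambda_1+\lambda_2<1$, $$\limsup_{n\to\infty}\frac1n\log\log N_{\rm sim}(n,\lambda_1,\lambda_2)\le\log\min\{|A|,|B|\}.$$
   Context: $\log$ is base 2 and $|A|$ denotes the dimension of $A$. Identification code: a classical identification code for a channel $\mathcal{N}:A\to B$ with error probability $\lambda_1$ of first and $\lambda_2$ of second kind is a set $\{(\rho_i,D_i):i=1,\dots,N\}$ of states $\rho_i$ on $A$ and operators $D_i$ on $B$ with $0\le D_i\le\mathbb{1}_B$ such that $\mathrm{Tr}(\mathcal{N}(\rho_i)D_i)\ge1-\lambda_1$ for all $i$ and $\mathrm{Tr}(\mathcal{N}(\rho_i)D_j)\le\lambda_2$ for all $i\ne j$. For the memoryless channel $\mathcal{N}^{\otimes n}$ it is called an $(n,\lambda_1,\lambda_2)$-ID code, and $N(n,\lambda_1,\lambda_2)$ is the largest size $N$ of such a code. The code is simultaneous if there exist a POVM $(E_t)_{t=1}^T$ and subsets $\mathcal{D}_i\subset\{1,\dots,T\}$ such that $D_i=\sum_{t\in\mathcal{D}_i}E_t$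 for all $i$; $N_{\rm sim}(n,\lambda_1,\lambda_2)$ is the largest size of a simultaneous $(n,\lambda_1,\lambda_2)$-ID code. Capacities: $C_{\rm ID}(\mathcal{N})=\inf_{\lambda>0}\liminf_{n\to\infty}\frac1n\log\log N(n,\lambda,\lambda)$ and $C_{\rm ID}^{\rm sim}(\mathcal{N})=\inf_{\lambda>0}\liminf_{n\to\infty}\frac1n\log\log N_{\rm sim}(n,\lambda,\lambda)$. *)

(* Defs.v *)
From HB Require Import structures.
From mathcomp Require Import all_boot all_order all_algebra.
From mathcomp Require Import complex.
From mathcomp Require mxtens.
From mathcomp Require Import all_classical all_reals all_analysis.

Set Implicit Arguments.
Unset Strict Implicit.
Unset Printing Implicit Defensive.

Import Order.TTheory GRing.Theory Num.Theory.
Import numFieldNormedType.Exports.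

Local Open Scope classical_set_scope.
Local Open Scope ring_scope.
Local Open Scope complex_scope.

(* A Hilbert space of dimension d is C^d with its standard basis, and 'M[R[i]]_d
   is the algebra of its operators. *)
Section Operators.
Context {R : realType}.
Local Notation C := R[i].

Definition adjmx m n (A : 'M[C]_(m, n)) : 'M[C]_(n, m) := map_mx Num.conj A^T.

(* On R[i], 0 <= z means that z is real and nonnegative, so a positive
   semidefinite operator is Hermitian. *)
Definition psdmx d (M : 'M[C]_d) : Prop :=
  forall v : 'cV[C]_d, 0 <= (adjmx v *m M *m v) 0 0.

Definition state d (rho : 'M[C]_d) : Prop := psdmx rho /\ \tr rho = 1.

Definition effect d (D : 'M[C]_d) : Prop := psdmx D /\ psdmx (1%:M - D).

Definition povm d T (E : 'I_T -> 'M[C]_d) : Prop :=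
  (forall t, psdmx (E t)) /\ \sum_t E t = 1%:M.

(* Phi ⊗ Psi, expanded on matrix units (Phi and Psi are meant to be linear);
   the basis vector e_i ⊗ e_k has index mxtens_index (i, k), as in tensmx. *)
Definition tensmap a b a' b' (Phi : 'M[C]_a -> 'M[C]_b)
    (Psi : 'M[C]_a' -> 'M[C]_b') (X : 'M[C]_(a * a')) : 'M[C]_(b * b') :=
  \sum_(i < a) \sum_(j < a) \sum_(k < a') \sum_(l < a')
    X (mxtens.mxtens_index (i, k)) (mxtens.mxtens_index (j, l)) *:
      mxtens.tensmx (Phi (delta_mx i j)) (Psi (delta_mx k l)).

Lemma tensmap_tensmx a b a' b' (Phi : {linear 'M[C]_a -> 'M[C]_b})
    (Psi : {linear 'M[C]_a' -> 'M[C]_b'}) (X : 'M[C]_a) (Y : 'M[C]_a') :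
  tensmap Phi Psi (mxtens.tensmx X Y) = mxtens.tensmx (Phi X) (Psi Y).
Proof.
apply/matrixP => p q.
case: (mxtens.mxtens_indexP p) => p1 p2; case: (mxtens.mxtens_indexP q) => q1 q2.
rewrite mxtens.tensmxE {2}(matrix_sum_delta X) {2}(matrix_sum_delta Y) !linear_sum.
rewrite !summxE big_distrl /=; apply: eq_bigr => i _.
rewrite !linear_sum !summxE big_distrl /=; apply: eq_bigr => j _.
rewrite summxE big_distrr /=; apply: eq_bigr => k _.
rewrite linear_sum !summxE big_distrr /=; apply: eq_bigr => l _.
by rewrite mxE !mxtens.tensmxE !linearZ !mxE /= mulrACA.
Qed.

(* The n-fold tensor power; the case split on n follows mxtens.ntensmx, because
   d ^ 1 is convertible to d and not to d * 1. *)
Fixpoint ntensmap_rec a b (Phi : 'M[C]_a -> 'M[C]_b) k :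
    'M[C]_(a ^ k.+1) -> 'M[C]_(b ^ k.+1) :=
  if k is k'.+1 return 'M[C]_(a ^ k.+1) -> 'M[C]_(b ^ k.+1)
  then tensmap Phi (ntensmap_rec Phi (k := k')) else Phi.

Definition ntensmap a b (Phi : 'M[C]_a -> 'M[C]_b) n :
    'M[C]_(a ^ n) -> 'M[C]_(b ^ n) :=
  if n is k.+1 return 'M[C]_(a ^ n) -> 'M[C]_(b ^ n)
  then ntensmap_rec Phi (k := k) else id.

Definition completely_positive a b (Phi : 'M[C]_a -> 'M[C]_b) : Prop :=
  forall k (X : 'M[C]_(k * a)),
    psdmx X -> psdmx (tensmap (id : 'M[C]_k -> 'M[C]_k) Phi X).

Definition trace_preserving a b (Phi : 'M[C]_a -> 'M[C]_b) : Prop :=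
  forall X, \tr (Phi X) = \tr X.

Definition cptp a b (Phi : {linear 'M[C]_a -> 'M[C]_b}) : Prop :=
  completely_positive Phi /\ trace_preserving Phi.

Definition idchan d : 'M[C]_d -> 'M[C]_d := idfun.

End Operators.

Arguments idchan : clear implicits.

Section Identification.
Context {R : realType}.
Local Notation C := R[i].

(* A code is an indexed family (rho i, D i), i < N; its members are automatically
   pairwise distinct when l1 + l2 < 1. *)
Definition id_code a b (Phi : 'M[C]_a -> 'M[C]_b) (l1 l2 : R) N
    (rho : 'I_N -> 'M[C]_a) (D : 'I_N -> 'M[C]_b) : Prop :=
  [/\ forall i, state (rho i),
      forall i, effect (D i),
      forall i, (1 - l1)%:C <= \tr (Phi (rho i) *m D i) &
      forall i j, i != j -> \tr (Phi (rho i) *m D j) <= l2%:C].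

Definition simultaneous b N (D : 'I_N -> 'M[C]_b) : Prop :=
  exists T (E : 'I_T -> 'M[C]_b) (S : 'I_N -> {set 'I_T}),
    povm E /\ forall i, D i = \sum_(t in S i) E t.

(* The supremum is taken in \bar R: it is the maximum when the sizes are
   bounded, and +oo otherwise. *)
Definition largest_size (P : nat -> Prop) : \bar R :=
  ereal_sup [set (N%:R)%:E | N in [set N : nat | P N]].

Definition ID_size a b (Phi : 'M[C]_a -> 'M[C]_b) n (l1 l2 : R) : \bar R :=
  largest_size (fun N =>
    exists (rho : 'I_N -> 'M[C]_(a ^ n)) (D : 'I_N -> 'M[C]_(b ^ n)),
      id_code (ntensmap Phi (n := n)) l1 l2 rho D).

Definition ID_sim_size a b (Phi : 'M[C]_a -> 'M[C]_b) n (l1 l2 : R) : \bar R :=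
  largest_size (fun N =>
    exists (rho : 'I_N -> 'M[C]_(a ^ n)) (D : 'I_N -> 'M[C]_(b ^ n)),
      id_code (ntensmap Phi (n := n)) l1 l2 rho D /\ simultaneous D).

(* log2 0 = -oo and log2 +oo = +oo. *)
Definition log2 (x : \bar R) : \bar R := (lne x * ((ln 2)^-1)%:E)%E.

(* The value at n = 0 is irrelevant to the limits below. *)
Definition loglog_rate (N : nat -> \bar R) (n : nat) : \bar R :=
  ((n%:R^-1)%:E * log2 (log2 (N n)))%E.

Definition C_ID a b (Phi : 'M[C]_a -> 'M[C]_b) : \bar R :=
  ereal_inf [set limn_einf (loglog_rate (fun n => ID_size Phi n l l)) |
             l in [set l : R | 0 < l]].

Definition C_ID_sim a b (Phi : 'M[C]_a -> 'M[C]_b) : \bar R :=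
  ereal_inf [set limn_einf (loglog_rate (fun n => ID_sim_size Phi n l l)) |
             l in [set l : R | 0 < l]].

End Identification.

(* Main.v *)
(* Strong converse.  Moving the POVM to the input or the states to the output of the
   channel reduces everything to simultaneous codes on C^d, with d = min(|A|,|B|)^n.
   Split the POVM into many operators of the same small trace; then repeatedly discard
   about half of them and double the others, choosing the survivors at random.  By a
   noncommutative Khintchine inequality (moments Tr X^(2p) of random signed sums) the
   operators D_1, ..., D_N are all preserved in operator norm until about d log(N d)
   elements remain.  Continuing for one D_i alone, about d log d of these suffice to
   represent it.  Hence N <= (C d log(N d))^(C d log d), which bounds N by 2^(d n^3) for
   large n.

   Lower bounds.  For simultaneous codes take uniform distributions on the graphs of
   functions [2^(n-s)] -> [2^s] that pairwise agree in few places.  For general codes take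
   the normalized G G^T, with G a random sign matrix of size 2^n x 2^(n-s), and the
   projection P onto the range of G: for a fixed P and a random sign vector g, the
   exponential moment of |P g|^2 shows that two random choices collide with probability
   at most exp(-c 4^n).

   Upper bound for C_ID(id_2).  By the pigeonhole principle on the 4^n entries of the
   states, two of them would be close if the code had more than 2^(4^n n^3) elements. *)

Require Import Defs.
From HB Require Import structures.
From mathcomp Require Import all_classical all_reals all_analysis.
From mathcomp Require Import all_boot all_order all_algebra.
From mathcomp Require Import complex.
From mathcomp Require mxtens.
From mathcomp Require Import ring lra zify.

Set Implicit Arguments.
Unset Strict Implicit.
Unset Printing Implicit Defensive.

Import Order.TTheory GRing.Theory Num.Theory.
Local Open Scope ring_scope.

(** * Hermitian matrices *)

Section HermitianMatrices.
Context {R : realType}.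
Local Notation C := R[i].

Lemma adjmxM m n p (A : 'M[C]_(m, n)) (B : 'M[C]_(n, p)) :
  adjmx (A *m B) = adjmx B *m adjmx A.
Proof. by rewrite /adjmx trmx_mul map_mxM. Qed.

Lemma adjmxK m n (A : 'M[C]_(m, n)) : adjmx (adjmx A) = A.
Proof. by apply/matrixP => i j; rewrite !mxE conjCK. Qed.

Lemma adjmxE m n (A : 'M[C]_(m, n)) i j : adjmx A i j = (A j i)^*%R.
Proof. by rewrite !mxE. Qed.

Lemma adjmxD m n (A B : 'M[C]_(m, n)) : adjmx (A + B) = adjmx A + adjmx B.
Proof. by apply/matrixP => i j; rewrite !mxE rmorphD. Qed.

Lemma adjmx0 m n : adjmx (0 : 'M[C]_(m, n)) = 0.
Proof. by apply/matrixP => i j; rewrite !mxE rmorph0. Qed.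

Lemma adjmx1 n : adjmx (1%:M : 'M[C]_n) = 1%:M.
Proof. by rewrite /adjmx trmx1 map_mx1. Qed.

Lemma adjmx_sum (I : finType) (P : pred I) m n (F : I -> 'M[C]_(m, n)) :
  adjmx (\sum_(i | P i) F i) = \sum_(i | P i) adjmx (F i).
Proof. exact: (big_morph _ (@adjmxD m n) (@adjmx0 m n)). Qed.

Lemma adjmxZ m n (c : C) (A : 'M[C]_(m, n)) : adjmx (c *: A) = c^*%R *: adjmx A.
Proof. by apply/matrixP => i j; rewrite !mxE rmorphM. Qed.

Lemma psdmx0 n : psdmx (0 : 'M[C]_n).
Proof. by move=> v; rewrite mulmx0 mul0mx mxE. Qed.

Lemma psdmxD n (A B : 'M[C]_n) : psdmx A -> psdmx B -> psdmx (A + B).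
Proof. by move=> hA hB v; rewrite mulmxDr mulmxDl mxE addr_ge0. Qed.

Lemma psdmxZ n (c : C) (A : 'M[C]_n) : 0 <= c -> psdmx A -> psdmx (c *: A).
Proof. by move=> c0 hA v; rewrite -scalemxAr -scalemxAl mxE mulr_ge0. Qed.

Lemma psdmx_sum (I : finType) (P : pred I) n (F : I -> 'M[C]_n) :
  (forall i, P i -> psdmx (F i)) -> psdmx (\sum_(i | P i) F i).
Proof. by move=> hF; apply: (big_ind (@psdmx R n)); [exact: psdmx0|exact: psdmxD|exact: hF]. Qed.

Lemma psdmx_congr m n (K : 'M[C]_(m, n)) (M : 'M[C]_m) :
  psdmx M -> psdmx (adjmx K *m M *m K).
Proof. by move=> hM v; have := hM (K *m v); rewrite adjmxM !mulmxA. Qed.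

Lemma psdmx_diag n (x : 'rV[C]_n) : (forall j, 0 <= x 0 j) -> psdmx (diag_mx x).
Proof.
move=> x0 v; rewrite -mulmxA mxE sumr_ge0 // => i _.
rewrite mul_diag_mx !mxE mulrCA mulr_ge0 //.
by rewrite mulrC -normCK exprn_ge0.
Qed.

Lemma psdmx1 n : psdmx (1%:M : 'M[C]_n).
Proof.
rewrite -diag_const_mx; apply: psdmx_diag => j; rewrite mxE; exact: ler01.
Qed.

Lemma form_delta n (M : 'M[C]_n) (i j : 'I_n) :
  (adjmx (delta_mx i 0 : 'cV[C]_n) *m M *m (delta_mx j 0 : 'cV[C]_n)) 0 0 = M i j.
Proof.
rewrite -mulmxA mxE (bigD1 i) //= big1 ?addr0; last first.
  move=> k ki; rewrite adjmxE mxE (negPf ki) /= conjC0 mul0r.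
  by [].
rewrite adjmxE mxE !eqxx /= conjC1 mul1r mxE (bigD1 j) //= big1 ?addr0.
  by rewrite mxE !eqxx mulr1.
by move=> k kj; rewrite mxE (negPf kj) mulr0.
Qed.

Lemma psdmx_diag_ge0 n (M : 'M[C]_n) i : psdmx M -> 0 <= M i i.
Proof. by move=> hM; rewrite -form_delta. Qed.

Lemma psdmx_tr_ge0 n (M : 'M[C]_n) : psdmx M -> 0 <= \tr M.
Proof. by move=> hM; apply: sumr_ge0 => i _; exact: psdmx_diag_ge0. Qed.

Lemma form_delta2 n (M : 'M[C]_n) (i j : 'I_n) (c : C) :
  let v : 'cV[C]_n := delta_mx i 0 + c *: delta_mx j 0 in
  (adjmx v *m M *m v) 0 0 = M i i + c * M i j + c^*%R * M j i + `|c| ^+ 2 * M j j.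
Proof.
pose f (A B : 'cV[C]_n) := (adjmx A *m M *m B) 0 0.
have fDl A B D : f (A + B) D = f A D + f B D by rewrite /f adjmxD !mulmxDl mxE.
have fDr A B D : f D (A + B) = f D A + f D B by rewrite /f !mulmxDr mxE.
have fZl a A B : f (a *: A) B = a^*%R * f A B by rewrite /f adjmxZ -!scalemxAl mxE.
have fZr a A B : f A (a *: B) = a * f A B by rewrite /f -!scalemxAr mxE.
rewrite /= -/(f _ _) fDl !fDr !fZl !fZr /f !form_delta normCK !addrA mulrA.
by rewrite (mulrC c c^*%R).
Qed.

(** Polarisation: the form at e_i + c e_j is real for every c, hence so is c M_ij plus the conjugate
    of c times M_ji. The choices c = 1 and c = i force M_ij and M_ji to be conjugate. *)
Lemma psdmx_herm n (M : 'M[C]_n) : psdmx M -> adjmx M = M.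
Proof.
move=> hM; apply/matrixP => i j; rewrite adjmxE.
have h c : (c * M i j + c^*%R * M j i) \is Num.real.
  have /ger0_real := hM (delta_mx i 0 + c *: delta_mx j 0).
  rewrite form_delta2 => h.
  have -> : c * M i j + c^* %R * M j i =
    (M i i + c * M i j + c^*%R * M j i + `|c| ^+ 2 * M j j) -
       (M i i + `|c| ^+ 2 * M j j) by ring.
  by rewrite rpredB // rpredD // ?rpredM ?rpredX ?ger0_real ?psdmx_diag_ge0.
set x := M i j in h *; set y := M j i in h *.
have h1 : (- 'i * x^* + 'i * y^* = 'i * x + - 'i * y)%R.
  by have := CrealP (h 'i%R); rewrite rmorphD 2!rmorphM /= conjCK conjCi.
have h2 : (x^* + y^* = x + y)%R.
  by have := CrealP (h 1); rewrite rmorphD 2!rmorphM /= conjCK conjC1 !mul1r.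
have h3 : (x^*%R - y + (x - y^*%R)) = 0.
  apply/(mulfI (neq0Ci C)); rewrite mulr0.
  have -> : ('i * (x^* - y + (x - y^*)) = - (- 'i * x^* + 'i * y^*) + ('i * x + - 'i * y))%R.
    ring.
  by rewrite h1 addrC subrr.
have h4 : (x^*%R - y - (x - y^*%R)) = 0.
  have -> : (x^*%R - y - (x - y^*%R)) = (x^* + y^* - (x + y))%R by ring.
  by rewrite h2 subrr.
have h5 : 2%:R * (x - y^*) = 0 :> C.
  have -> : (2%:R * (x - y^*) = (x^* - y + (x - y^*)) - (x^* - y - (x - y^*)))%R by ring.
  by rewrite h3 h4 subr0.
apply/eqP; move/eqP: h5; rewrite mulf_eq0 pnatr_eq0 /= subr_eq0 => /eqP ->.
by rewrite eqxx.
Qed.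

Lemma herm_spectral n (X : 'M[C]_n) : adjmx X = X ->
  exists (U : 'M[C]_n) (x : 'rV[C]_n),
    [/\ U *m adjmx U = 1%:M, adjmx U *m U = 1%:M,
        forall j, x 0 j \is Num.real & X = adjmx U *m diag_mx x *m U].
Proof.
move=> hX; have hX' : X \is hermsymmx.
  apply/is_hermitianmxP; rewrite expr0 scale1r -[LHS]hX /adjmx.
  by apply/matrixP => i j; rewrite !mxE.
have /orthomx_spectralP eX := hermitian_normalmx hX'.
have U1 := spectral_unitarymx X.
exists (spectralmx X), (spectral_diag X); split.
- by have /unitarymxP := U1; rewrite /adjmx.
- apply: mulmx1C; by have /unitarymxP := U1; rewrite /adjmx.
- by move=> j; have /mxOverP := hermitian_spectral_diag_real hX'; exact.
- by rewrite {1}eX invmx_unitary.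
Qed.

Lemma expmx_spectral n (U : 'M[C]_n) (x : 'rV[C]_n) k : U *m adjmx U = 1%:M ->
  adjmx U *m U = 1%:M ->
  (adjmx U *m diag_mx x *m U) ^+ k = adjmx U *m diag_mx (map_mx (fun c => c ^+ k) x) *m U.
Proof.
move=> U1 U2; elim: k => [|k IH].
  rewrite expr0 (_ : map_mx _ x = const_mx 1) ?diag_const_mx ?mulmx1 ?U2 //.
  by apply/matrixP => i j; rewrite !mxE expr0.
rewrite exprS IH -!mulmxE !mulmxA -[_ *m U *m adjmx U]mulmxA U1 mulmx1.
rewrite -[_ *m diag_mx x *m diag_mx _]mulmxA mulmx_diag; congr (_ *m diag_mx _ *m _).
by apply/matrixP => i j; rewrite !mxE exprS ord1.
Qed.

Lemma tr_expmx_spectral n (U : 'M[C]_n) (x : 'rV[C]_n) k : U *m adjmx U = 1%:M ->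
  adjmx U *m U = 1%:M ->
  \tr ((adjmx U *m diag_mx x *m U) ^+ k) = \sum_j x 0 j ^+ k.
Proof.
move=> U1 U2; rewrite expmx_spectral // mxtrace_mulC mulmxA U1 mul1mx mxtrace_diag.
by apply: eq_bigr => j _; rewrite mxE.
Qed.

Lemma psdmx_spectral n (U : 'M[C]_n) (x : 'rV[C]_n) : (forall j, 0 <= x 0 j) ->
  psdmx (adjmx U *m diag_mx x *m U).
Proof. by move=> x0; apply: psdmx_congr; exact: psdmx_diag. Qed.

Lemma psdmx_eigen_ge0 n (U : 'M[C]_n) (x : 'rV[C]_n) : U *m adjmx U = 1%:M ->
  psdmx (adjmx U *m diag_mx x *m U) -> forall j, 0 <= x 0 j.
Proof.
move=> U1 h j; have := psdmx_diag_ge0 j (psdmx_congr (adjmx U) h).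
rewrite adjmxK !mulmxA U1 mul1mx -mulmxA U1 mulmx1 mxE eqxx mulr1n.
by [].
Qed.

Lemma psdmx_scalar_sub n (A : 'M[C]_n) (c : C) (U : 'M[C]_n) (x : 'rV[C]_n) :
  adjmx U *m U = 1%:M -> (forall j, x 0 j <= c) ->
  psdmx (c%:M - adjmx U *m diag_mx x *m U).
Proof.
move=> U2 xc; have -> : c%:M = adjmx U *m c%:M *m U.
  by rewrite scalar_mxC -mulmxA U2 mulmx1.
rewrite -mulmxBl -mulmxBr -diag_const_mx -raddfB; apply: psdmx_spectral => j.
by rewrite !mxE subr_ge0.
Qed.

Lemma herm_exp n (X : 'M[C]_n) k : adjmx X = X -> adjmx (X ^+ k) = X ^+ k.
Proof.
move=> hX; elim: k => [|k IH]; first by rewrite expr0 adjmx1.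
by rewrite {1}exprS -mulmxE adjmxM IH hX mulmxE -exprSr.
Qed.

Lemma psdmx_exp_even n (X : 'M[C]_n) k : adjmx X = X -> psdmx (X ^+ (k + k)).
Proof.
move=> hX; rewrite exprD -{1}(herm_exp k hX) -[X in psdmx (X * _)]mulr1.
by rewrite -!mulmxE; apply: psdmx_congr; exact: psdmx1.
Qed.

Lemma psdmx_tr_mul_ge0 n (A B : 'M[C]_n) : psdmx A -> psdmx B -> 0 <= \tr (A *m B).
Proof.
move=> hA hB; have [U [x [U1 U2 xr eA]]] := herm_spectral (psdmx_herm hA).
rewrite eA in hA; rewrite eA -!mulmxA mxtrace_mulC -!mulmxA; have x0 := psdmx_eigen_ge0 U1 hA.
rewrite /mxtrace sumr_ge0 // => i _; rewrite mul_diag_mx mxE mulr_ge0 //.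
have := psdmx_diag_ge0 i (psdmx_congr (adjmx U) hB).
by rewrite adjmxK mulmxA.
Qed.

Lemma real_normX_even (z : C) p : z \is Num.real -> `|z| ^+ (p + p) = z ^+ (p + p).
Proof.
by move=> zr; rewrite addnn -mul2n !exprM real_normK.
Qed.

(* The eigenvalues x of X satisfy |x|^(2p) <= Tr X^(2p). *)
Lemma herm_bound_tr_exp n (X : 'M[C]_n) (c : C) p : adjmx X = X -> 0 <= c -> (0 < p)%N ->
  \tr (X ^+ (p + p)) <= c ^+ (p + p) -> psdmx (c%:M - X) /\ psdmx (c%:M + X).
Proof.
move=> hX c0 p0 h; have [U [x [U1 U2 xr eX]]] := herm_spectral hX.
have xc j : `|x 0 j| <= c.
  rewrite -(@ler_pXn2r _ (p + p)) ?nnegrE ?addn_gt0 ?p0 //.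
  apply: le_trans h; rewrite eX tr_expmx_spectral // (bigD1 j) //=.
  rewrite real_normX_even // lerDl; apply: sumr_ge0 => k _.
  by rewrite -real_normX_even // exprn_ge0.
split.
  rewrite eX; apply: psdmx_scalar_sub => // j.
  by have := xc j; rewrite real_ler_norml ?xr // => /andP[].
rewrite -[X]opprK; have -> : - X = adjmx U *m diag_mx (- x) *m U.
  by rewrite raddfN /= mulmxN mulNmx -eX.
apply: psdmx_scalar_sub => // j; have := xc j; rewrite real_ler_norml ?xr // => /andP[].
by rewrite mxE => h1 _; rewrite lerNl.
Qed.

(** In eigenbases of X and Y the traces become sums of |G_ij|^2 times monomials in the eigenvalues,
    and |x|^q |y|^s is at most the larger of x^(2r) and y^(2r). Absolute values enter because q and
    s may be odd. *)
Lemma tr_sandwich n (H X Y : 'M[C]_n) : adjmx H = H -> adjmx X = X -> adjmx Y = Y ->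
  forall r q s, (q + s)%N = (r + r)%N ->
  \tr (H * X ^+ q * H * Y ^+ s) <= \tr (H ^+ 2 * X ^+ (r + r)) + \tr (H ^+ 2 * Y ^+ (r + r)).
Proof.
move=> hH hX hY r q s qsr.
have [U [x [U1 U2 xr eX]]] := herm_spectral hX.
have [V [y [V1 V2 yr eY]]] := herm_spectral hY.
pose G := U *m H *m adjmx V.
have key a b : \tr (H * X ^+ a * H * Y ^+ b) =
    \sum_i \sum_j `|G i j| ^+ 2 * (x 0 i ^+ a * y 0 j ^+ b).
  have -> : \tr (H * X ^+ a * H * Y ^+ b) =
     \tr (adjmx G *m diag_mx (map_mx (fun c => c ^+ a) x) *m G *m
          diag_mx (map_mx (fun c => c ^+ b) y)).
    rewrite eX eY !expmx_spectral // -!mulmxE.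
    rewrite /G !adjmxM adjmxK hH !mulmxA mxtrace_mulC !mulmxA.
    by [].
  rewrite exchange_big /=; apply: eq_bigr => j _.
  rewrite mul_mx_diag mxE.
  rewrite [in RHS](eq_bigr (fun i => (adjmx G j i * x 0 i ^+ a * G i j) * y 0 j ^+ b)).
    rewrite -mulr_suml !mxE; congr (_ * _); apply: eq_bigr => i _.
    by rewrite mul_mx_diag !mxE.
  by move=> i _; rewrite adjmxE normCK; ring.
have kX : \tr (H ^+ 2 * X ^+ (r + r)) = \tr (H * X ^+ (r + r) * H * Y ^+ 0).
  by rewrite expr0 mulr1 -!mulmxE -[RHS]mxtrace_mulC mulmxA expr2 mulmxE.
have kY : \tr (H ^+ 2 * Y ^+ (r + r)) = \tr (H * X ^+ 0 * H * Y ^+ (r + r)).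
  by rewrite expr0 mulr1 expr2.
have kX' := etrans kX (key (r + r)%N 0).
have kY' := etrans kY (key 0 (r + r)%N).
rewrite [leLHS]key.
rewrite [X in X + _]kX' [X in _ + X]kY'.
rewrite -big_split; apply: ler_sum => i _; rewrite -big_split; apply: ler_sum => j _ /=.
rewrite -mulrDr ler_wpM2l ?exprn_ge0 // expr0 mulr1 mul1r.
rewrite -(real_normX_even r (xr i)) -(real_normX_even r (yr j)).
apply: le_trans (real_ler_norm _) _; first by rewrite rpredM ?rpredX.
rewrite normrM !normrX -qsr.
have [h|/ltW h] := real_leP (normr_real (x 0 i)) (normr_real (y 0 j)).
- rewrite ler_wpDl ?exprn_ge0 // exprD ler_wpM2r ?exprn_ge0 //.
  by rewrite lerXn2r // nnegrE.
- rewrite ler_wpDr ?exprn_ge0 // exprD ler_wpM2l ?exprn_ge0 //.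
  by rewrite lerXn2r // nnegrE.
Qed.

End HermitianMatrices.

(** * A noncommutative Khintchine inequality *)

Section RandomSigns.
Context {R : realType}.
Local Notation C := R[i].

Lemma subrX_telescope (A : pzRingType) (X Y : A) n :
  X ^+ n - Y ^+ n = \sum_(i < n) X ^+ i * (X - Y) * Y ^+ (n - i.+1).
Proof.
elim: n => [|n IH]; first by rewrite big_ord0 !expr0 subrr.
rewrite big_ord_recl expr0 mul1r subSS subn0.
have -> : X ^+ n.+1 - Y ^+ n.+1 = (X - Y) * Y ^+ n + X * (X ^+ n - Y ^+ n).
  by rewrite mulrBl mulrBr -!exprS [RHS]addrC addrA addrNK.
rewrite IH mulr_sumr; congr (_ + _); apply: eq_bigr => i _.
by rewrite /bump /= exprS !mulrA subSS.
Qed.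

Definition signsum (T : finType) n (H : T -> 'M[C]_n) (eps : {ffun T -> bool}) :=
  \sum_t (-1) ^+ eps t *: H t.

Definition flip (T : finType) (t : T) (eps : {ffun T -> bool}) : {ffun T -> bool} :=
  [ffun s => (s == t) (+) eps s].

Lemma flipK (T : finType) (t : T) : involutive (flip t).
Proof. by move=> eps; apply/ffunP => s; rewrite !ffunE addKb. Qed.

Lemma flip_sign (T : finType) (t : T) eps :
  (-1) ^+ flip t eps t = - (-1) ^+ eps t :> C.
Proof. by rewrite ffunE eqxx /= signrN. Qed.

Lemma sum_flip (V : nmodType) (T : finType) (t : T) (f : {ffun T -> bool} -> V) :
  \sum_eps f (flip t eps) = \sum_eps f eps.
Proof. by rewrite [RHS](reindex_inj (inv_inj (flipK t))). Qed.

Lemma signsum_flip (T : finType) n (H : T -> 'M[C]_n) t eps :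
  signsum H eps - signsum H (flip t eps) = (2%:R * (-1) ^+ eps t) *: H t.
Proof.
rewrite /signsum (bigD1 t) //= [in X in _ - X](bigD1 t) //= flip_sign.
have -> : \sum_(s | s != t) (-1) ^+ flip t eps s *: H s =
    \sum_(s | s != t) (-1) ^+ eps s *: H s.
  by apply: eq_bigr => s st; rewrite ffunE (negPf st).
by rewrite opprD addrACA subrr addr0 scaleNr opprK -scalerDl -mulr2n mulr_natl.
Qed.

Lemma signsum_herm (T : finType) n (H : T -> 'M[C]_n) eps :
  (forall t, adjmx (H t) = H t) -> adjmx (signsum H eps) = signsum H eps.
Proof.
move=> hH; rewrite /signsum adjmx_sum; apply: eq_bigr => t _.
by rewrite adjmxZ hH rmorphXn rmorphN1.
Qed.

(* Adding the terms of eps and flip t eps leaves a difference of powers, which telescopes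
   into a sum of products that are quadratic in H t. *)
Lemma tr_signsum_step (T : finType) n (H : T -> 'M[C]_n) r t :
  (forall t, adjmx (H t) = H t) ->
  \sum_(eps : {ffun T -> bool}) (-1) ^+ eps t * \tr (H t * signsum H eps ^+ (r + r).+1) <=
  ((r + r).+1 * 2)%:R * \sum_(eps : {ffun T -> bool}) \tr (H t ^+ 2 * signsum H eps ^+ (r + r)).
Proof.
move=> hH; pose X := signsum H; pose s (eps : {ffun T -> bool}) : C := (-1) ^+ eps t.
rewrite -/X; set L := leLHS.
have sX eps := signsum_herm eps hH.
have L2 : L = - \sum_(eps : {ffun T -> bool}) s eps * \tr (H t * X (flip t eps) ^+ (r + r).+1).
  have -> : L = \sum_eps s (flip t eps) * \tr (H t * X (flip t eps) ^+ (r + r).+1).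
    by rewrite (sum_flip t (fun eps => s eps * \tr (H t * X eps ^+ (r + r).+1))).
  rewrite -sumrN; apply: eq_bigr => eps _.
  by rewrite /s flip_sign mulNr.
have LL : L + L = 2%:R * \sum_(eps : {ffun T -> bool}) \sum_(q < (r + r).+1)
    \tr (H t * X eps ^+ q * H t * X (flip t eps) ^+ ((r + r).+1 - q.+1)).
  rewrite {2}L2 /L -sumrB mulr_sumr; apply: eq_bigr => eps _.
  rewrite -mulrBr -raddfB /= -mulrBr subrX_telescope signsum_flip.
  rewrite [X in \tr X]mulr_sumr raddf_sum [LHS]mulr_sumr [RHS]mulr_sumr.
  apply: eq_bigr => q _ /=.
  rewrite -!mulmxE -scalemxAr -scalemxAl -scalemxAr mxtraceZ mulrA mulrCA.
  by rewrite -expr2 sqrr_sign mulr1 !mulmxA.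
have bound eps : \sum_(q < (r + r).+1)
    \tr (H t * X eps ^+ q * H t * X (flip t eps) ^+ ((r + r).+1 - q.+1)) <=
    (r + r).+1%:R * (\tr (H t ^+ 2 * X eps ^+ (r + r)) +
                     \tr (H t ^+ 2 * X (flip t eps) ^+ (r + r))).
  rewrite [leRHS]mulr_natl -[X in _ *+ X]card_ord -sumr_const; apply: ler_sum => q _.
  by apply: tr_sandwich; [exact: hH|exact: sX|exact: sX|rewrite subSS subnKC // -ltnS].
rewrite -(@ler_pM2l C 2%:R) ?ltr0n // [leLHS]mulr_natl mulr2n LL.
rewrite ler_pM2l ?ltr0n //; apply: (le_trans (ler_sum _ (fun eps _ => bound eps))).
rewrite -mulr_sumr big_split /=.
rewrite [X in _ * (_ + X)](sum_flip t (fun eps => \tr (H t ^+ 2 * X eps ^+ (r + r)))).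
by rewrite natrM -mulrA (mulr_natl _ 2) mulr2n.
Qed.

(** Write one factor of X^(2j+2) as the signed sum and apply [tr_signsum_step] to each index. Since
    X^(2j) is positive, the sum of the squares may be replaced by v, so each increase of j costs a
    factor 2 (2j+1) v, which is at most 4 p v for j < p. *)
Lemma tr_signsum_exp (T : finType) n (H : T -> 'M[C]_n) (v : C) p :
  (forall t, adjmx (H t) = H t) -> 0 <= v ->
  psdmx (v%:M - \sum_t H t ^+ 2) ->
  \sum_(eps : {ffun T -> bool}) \tr (signsum H eps ^+ (p + p)) <=
    ((4 * p)%:R * v) ^+ p * (#|{ffun T -> bool}| * n)%:R.
Proof.
move=> hH v0 hv; pose F j := \sum_(eps : {ffun T -> bool}) \tr (signsum H eps ^+ j).
have sX eps := signsum_herm eps hH.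
have step j : F (j.+1 + j.+1)%N <= ((j + j).+1 * 2)%:R * v * F (j + j)%N.
  have -> : F (j.+1 + j.+1)%N =
      \sum_t \sum_(eps : {ffun T -> bool}) (-1) ^+ eps t * \tr (H t * signsum H eps ^+ (j + j).+1).
    rewrite exchange_big /=; apply: eq_bigr => eps _.
    rewrite addSn addnS exprS {1}/signsum mulr_suml raddf_sum; apply: eq_bigr => t _.
    by rewrite /= -mulmxE -scalemxAl mxtraceZ.
  apply: (le_trans (ler_sum _ (fun t _ => tr_signsum_step j t hH))).
  rewrite -mulr_sumr -mulrA ler_wpM2l ?ler0n // exchange_big /= /F mulr_sumr.
  apply: ler_sum => eps _; rewrite -raddf_sum -mulr_suml -subr_ge0.
  have -> : v * \tr (signsum H eps ^+ (j + j)) = \tr (v%:M *m (signsum H eps ^+ (j + j))).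
    by rewrite mul_scalar_mx mxtraceZ.
  rewrite -raddfB -mulmxE -mulmxBl; apply: psdmx_tr_mul_ge0 => //.
  exact: psdmx_exp_even.
have F_ge0 j : 0 <= F (j + j)%N.
  by apply: sumr_ge0 => eps _; apply: psdmx_tr_ge0; exact: psdmx_exp_even.
suff h j : (j <= p)%N -> F (j + j)%N <= ((4 * p)%:R * v) ^+ j * F 0%N.
  apply: le_trans (h p (leqnn p)) _; rewrite le_eqVlt; apply/orP; left; apply/eqP.
  congr (_ * _); rewrite /F (eq_bigr (fun=> n%:R)) => [|eps _]; last first.
    by rewrite expr0 mxtrace1.
  by rewrite sumr_const natrM mulr_natl.
elim: j => [|j IH] jp; first by rewrite expr0 mul1r.
apply: le_trans (step j) _; rewrite exprS -[leRHS]mulrA; apply: ler_pM => //.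
- by rewrite mulr_ge0 ?ler0n.
- by rewrite ler_wpM2r // ler_nat; lia.
- exact/IH/ltnW.
Qed.

(** The order on complex numbers is partial; nonnegativity makes all values comparable with c, so
    that the strict opposite inequalities can be summed. *)
Lemma exists_le_mean (T : finType) (f : T -> C) (c : C) : 0 <= c -> (0 < #|T|)%N ->
  (forall x, 0 <= f x) -> \sum_x f x <= #|T|%:R * c -> exists x, f x <= c.
Proof.
move=> c0 T0 f0 h; apply/existsP; apply: contraLR h => /existsPn h.
have hlt x : c < f x by rewrite real_ltNge ?ger0_real.
rewrite -real_ltNge ?ger0_real ?mulr_ge0 ?ler0n ?sumr_ge0 //.
rewrite mulr_natl -sumr_const; apply: ltr_sum => //.
by case/card_gt0P: T0 => x _; apply/hasP; exists x; rewrite // mem_index_enum.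
Qed.

(* For Hermitian M and N: the operator norm of M - N is at most eta. *)
Definition opclose n (eta : C) (M N : 'M[C]_n) :=
  psdmx (eta%:M - (M - N)) /\ psdmx (eta%:M + (M - N)).

(** A union bound by moments: the traces of X_i^(2p), summed over i, are on average at most |I| n (4
    p v)^p <= (8 p v)^p <= eta^(2p). Signs that do no worse than the average serve all i at once. *)
Lemma opclose_sign (I T : finType) n (H : I -> T -> 'M[C]_n) (v eta : C) p :
  (forall i t, adjmx (H i t) = H i t) -> 0 <= v -> 0 <= eta -> (0 < p)%N ->
  (forall i, psdmx (v%:M - \sum_t H i t ^+ 2)) ->
  (8 * p)%:R * v <= eta ^+ 2 -> (#|I| * n <= 2 ^ p)%N ->
  exists eps, forall i, opclose eta (signsum (H i) eps) 0.
Proof.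
move=> hH v0 eta0 p0 hv hp hI.
have X0 i eps : 0 <= \tr (signsum (H i) eps ^+ (p + p)).
  by apply/psdmx_tr_ge0/psdmx_exp_even/signsum_herm.
have [||||eps heps] := @exists_le_mean _ (fun eps => \sum_i \tr (signsum (H i) eps ^+ (p + p)))
    (eta ^+ (p + p)).
- exact: exprn_ge0.
- by rewrite card_ffun expn_gt0 card_bool.
- by move=> eps; apply: sumr_ge0.
- rewrite exchange_big /=.
  apply: (le_trans (ler_sum _ (fun i _ => tr_signsum_exp p (hH i) v0 (hv i)))).
  have e (x y z w : C) : x * (y * (z * w)) = z * (y * (x * w)) by ring.
  rewrite sumr_const -[leLHS]mulr_natl (natrM _ _ n) e -natrM ler_wpM2l ?ler0n //.
  have -> : eta ^+ (p + p) = (eta ^+ 2) ^+ p by rewrite -exprM mul2n addnn.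
  apply: le_trans (_ : ((8 * p)%:R * v) ^+ p <= _); last first.
    by rewrite lerXn2r ?nnegrE ?exprn_ge0 ?mulr_ge0 ?ler0n.
  rewrite (_ : (8 * p)%:R * v = 2%:R * ((4 * p)%:R * v)); last first.
    by rewrite mulrA -natrM mulnA.
  rewrite [leRHS]exprMn [leRHS]mulrC ler_wpM2l ?exprn_ge0 ?mulr_ge0 ?ler0n //.
  by rewrite -natrX ler_nat.
exists eps => i; rewrite /opclose subr0.
apply: (herm_bound_tr_exp _ eta0 p0); first exact: signsum_herm.
by apply: le_trans heps; rewrite (bigD1 i) //= lerDl sumr_ge0.
Qed.

Lemma opclose_refl n eta (M : 'M[C]_n) : 0 <= eta -> opclose eta M M.
Proof.
move=> h; rewrite /opclose subrr subr0 addr0 -scalemx1.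
by split; apply: psdmxZ => //; apply: psdmx1.
Qed.

Lemma opclose_trans n e1 e2 (M N P : 'M[C]_n) :
  opclose e1 M N -> opclose e2 N P -> opclose (e1 + e2) M P.
Proof.
case=> a1 b1 [a2 b2]; split; rewrite raddfD /=.
  by have := psdmxD a1 a2; rewrite addrACA -opprD addrA addrNK.
by have := psdmxD b1 b2; rewrite addrACA [_ + (N - P)]addrA addrNK.
Qed.

Lemma opclose_le n e (b : C) (M N : 'M[C]_n) : opclose e M N -> psdmx (b%:M - N) ->
  psdmx ((b + e)%:M - M).
Proof.
move=> [h1 _] h2.
have -> : (b + e)%:M - M = (b%:M - N) + (e%:M - (M - N)).
  by rewrite raddfD /= opprB addrACA addKr.
exact: psdmxD.
Qed.

Lemma opclose_tr n e (M N rho : 'M[C]_n) : opclose e M N -> psdmx rho -> \tr rho = 1 ->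
  \tr (rho *m M) <= \tr (rho *m N) + e /\ \tr (rho *m N) <= \tr (rho *m M) + e.
Proof.
move=> [h1 h2] hr tr1.
have he : \tr (rho *m e%:M) = e by rewrite mul_mx_scalar mxtraceZ tr1 mulr1.
have := psdmx_tr_mul_ge0 hr h1; have := psdmx_tr_mul_ge0 hr h2.
rewrite mulmxDr mulmxBr mxtraceD raddfB /= he => a.
rewrite mulmxBr mulmxBr raddfB raddfB /= he => b.
move: a b; move: (\tr (rho *m M)) (\tr (rho *m N)) => x y a b.
split; rewrite -subr_ge0.
  by have -> : y + e - x = e - (x - y) by ring.
by have -> : x + e - y = e + (x - y) by ring.
Qed.

End RandomSigns.

(** * Sparsification of sums of positive operators *)

Section Halving.
Context {R : realType}.
Local Notation C := R[i].

Lemma sum_mask (T : finType) (V : lmodType C) (c : T -> C) (W : {set T}) (F : T -> V) :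
  \sum_t c t *: (if t \in W then F t else 0) = \sum_(t in W) c t *: F t.
Proof.
rewrite [RHS]big_mkcond; apply: eq_bigr => t _.
by case: ifP; rewrite ?scaler0.
Qed.

(** The sum of the squares is at most delta b because A_t^2 <= delta A_t. The signs split U in two;
    doubling one of the parts changes each sum by plus or minus the signed sum, so the smaller part
    can be kept. *)
Lemma halving_step (I T : finType) n (A : T -> 'M[C]_n) (S : I -> {set T}) (U : {set T})
    (delta b eta : C) p :
  (forall t, psdmx (A t)) -> (forall t, psdmx (delta *: A t - A t ^+ 2)) ->
  0 <= delta -> 0 <= b -> 0 <= eta -> (0 < p)%N ->
  (forall i, psdmx (b%:M - \sum_(t in S i :&: U) A t)) ->
  (8 * p)%:R * (delta * b) <= eta ^+ 2 -> (#|I| * n <= 2 ^ p)%N ->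
  exists U' : {set T}, [/\ U' \subset U, (2 * #|U'| <= #|U|)%N &
    forall i, opclose eta (2%:R *: \sum_(t in S i :&: U') A t) (\sum_(t in S i :&: U) A t)].
Proof.
move=> hA hA2 d0 b0 eta0 p0 hb heta hI.
pose H i t := if t \in S i :&: U then A t else 0.
have [||i|eps heps] := @opclose_sign _ I T n H (delta * b) eta p _ _ eta0 p0 _ heta hI.
- by move=> i t; rewrite /H; case: ifP => _; rewrite ?adjmx0 // psdmx_herm.
- exact: mulr_ge0.
- have -> : \sum_t H i t ^+ 2 = \sum_(t in S i :&: U) A t ^+ 2.
    rewrite [RHS]big_mkcond; apply: eq_bigr => t _; rewrite /H.
    by case: ifP; rewrite ?expr0n.
  have -> : (delta * b)%:M - \sum_(t in S i :&: U) A t ^+ 2 =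
     delta *: (b%:M - \sum_(t in S i :&: U) A t) +
     \sum_(t in S i :&: U) (delta *: A t - A t ^+ 2).
    by rewrite sumrB -scaler_sumr scalerBr scale_scalar_mx addrA addrNK.
  apply: psdmxD; first exact: psdmxZ.
  by apply: psdmx_sum => t _.
pose Up := [set t in U | ~~ eps t]; pose Um := [set t in U | eps t].
have cUU : (#|Up| + #|Um| = #|U|)%N.
  rewrite addnC -(cardsID [set t | eps t] U).
  have -> : U :&: [set t | eps t] = Um by apply/setP => t; rewrite !inE.
  by have -> : U :\: [set t | eps t] = Up by apply/setP => t; rewrite !inE andbC.
have split_sum (f : T -> 'M[C]_n) i : \sum_(t in S i :&: U) f t =
    \sum_(t in S i :&: Up) f t + \sum_(t in S i :&: Um) f t.
  rewrite (bigID (fun t => ~~ eps t)) /=; congr (_ + _); apply: eq_bigl => t.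
    by rewrite !inE andbA.
  by rewrite !inE negbK andbA.
have sgn i : signsum (H i) eps = \sum_(t in S i :&: Up) A t - \sum_(t in S i :&: Um) A t.
  rewrite /signsum sum_mask split_sum; congr (_ + _).
    by apply: eq_bigr => t; rewrite !inE => /and3P[_ _ /negPf ->]; rewrite expr0 scale1r.
  rewrite -sumrN; apply: eq_bigr => t; rewrite !inE => /and3P[_ _ ->].
  by rewrite expr1 scaleN1r.
have two (X Y : 'M[C]_n) : 2%:R *: X - (X + Y) = X - Y.
  by rewrite scaler_nat mulr2n opprD addrACA subrr add0r.
case: (leqP (2 * #|Up|) #|U|) => hU.
  exists Up; split; [by apply/subsetP => t; rewrite inE => /andP[]|exact: hU|move=> i].
  have := heps i; rewrite /opclose sgn subr0 split_sum two.
  exact.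
exists Um; split => [||i]; first by apply/subsetP => t; rewrite inE => /andP[].
  by move: hU; rewrite -cUU; lia.
have := heps i; rewrite /opclose sgn subr0 split_sum [_ + \sum_(t in S i :&: Um) _]addrC two.
rewrite -[\sum_(t in S i :&: Up) A t - _]opprB opprK => -[h1 h2].
by split; [exact: h2|exact: h1].
Qed.

(* Going backwards from the last step, the error allowed in each step shrinks by the
   factor 3/4, slower than the factor sqrt(1/2) of Khintchine's inequality; the errors
   then form a geometric series of sum 3 e. *)
Lemma halving_iter (I T : finType) n (A : T -> 'M[C]_n) (S : I -> {set T}) (U : {set T})
    (delta : C) p k :
  (forall t, psdmx (A t)) -> (forall t, psdmx (delta *: A t - A t ^+ 2)) ->
  0 <= delta -> (0 < p)%N -> (#|I| * n <= 2 ^ p)%N ->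
  (forall i, psdmx (2%:R%:M - \sum_(t in S i :&: U) A t)) ->
  forall e : C, 0 <= e -> 3%:R * e <= 1 -> (24 * p * 2 ^ k)%:R * delta <= e ^+ 2 ->
  exists U' : {set T}, [/\ U' \subset U, (2 ^ k * #|U'| <= #|U|)%N &
    forall i, opclose (3%:R * e) ((2 ^ k)%:R *: \sum_(t in S i :&: U') A t)
                      (\sum_(t in S i :&: U) A t)].
Proof.
move=> hA hA2 d0 p0 hI hU; elim: k => [|k IH] e e0 e1 he.
  exists U; split => //; first by rewrite expn0 mul1n.
  by move=> i; rewrite expn0 scale1r; apply: opclose_refl; rewrite mulr_ge0 ?ler0n.
(* The last halving may err by f and the earlier ones by 3 f together, and f + 3 f = 3 e. As 2
   (3/4)^2 = 9/8 >= 1, the hypothesis for k + 1 and e implies the one for k and f. *)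
pose f := 3%:R / 4%:R * e.
have f0 : 0 <= f by rewrite !mulr_ge0 ?invr_ge0 ?ler0n.
have fe : f <= e by rewrite ler_piMl // ler_pdivrMr ?ltr0n // mul1r ler_nat.
have hf : (24 * p * 2 ^ k)%:R * delta <= f ^+ 2.
  rewrite -(@ler_pM2l C 2%:R) ?ltr0n // mulrA -natrM.
  have -> : (2 * (24 * p * 2 ^ k) = 24 * p * 2 ^ k.+1)%N by rewrite expnS; lia.
  apply: le_trans he _; rewrite /f exprMn mulrA ler_peMl ?exprn_ge0 //.
  rewrite exprMn exprVn -!natrX mulrA -natrM ler_pdivlMr ?ltr0n // mul1r ler_nat.
  by [].
have [||U1 [sU1 cU1 hU1]] := IH f _ _ hf => //.
  by apply: le_trans e1; rewrite ler_wpM2l ?ler0n.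
(* The sums stay below 2 + 3 f <= 3; with the factor 8 of [halving_step] this explains the constant
   24. *)
have b3 i : psdmx (3%:R%:M - \sum_(t in S i :&: U1) (2 ^ k)%:R *: A t).
  rewrite -scaler_sumr.
  have -> : 3%:R%:M - (2 ^ k)%:R *: \sum_(t in S i :&: U1) A t =
     (1 - 3%:R * f)%:M + ((2%:R + 3%:R * f)%:M - (2 ^ k)%:R *: \sum_(t in S i :&: U1) A t).
    rewrite addrA -raddfD /=; congr (_%:M - _); ring.
  apply: psdmxD; last by apply: opclose_le (hU1 i) (hU i).
  rewrite -scalemx1; apply: psdmxZ; last exact: psdmx1.
  by rewrite subr_ge0; apply: le_trans e1; rewrite ler_wpM2l ?ler0n.
have [|t|||U2 [sU2 cU2 hU2]] := @halving_step I T n (fun t => (2 ^ k)%:R *: A t) S U1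
    ((2 ^ k)%:R * delta) 3%:R f p _ _ _ (ler0n _ _) f0 p0 b3 _ hI.
- by move=> t; apply: psdmxZ; rewrite ?ler0n.
- have -> : ((2 ^ k)%:R * delta) *: ((2 ^ k)%:R *: A t) - ((2 ^ k)%:R *: A t) ^+ 2 =
     (2 ^ k)%:R ^+ 2 *: (delta *: A t - A t ^+ 2).
    rewrite scalerBr !scalerA; congr (_ *: _ - _); first by rewrite mulrAC expr2.
    by rewrite !expr2 -!mulmxE -scalemxAl -scalemxAr scalerA.
  by apply: psdmxZ => //; rewrite exprn_ge0 ?ler0n.
- by rewrite mulr_ge0 ?ler0n.
- apply: le_trans hf.
  have -> : (8 * p)%:R * ((2 ^ k)%:R * delta * 3%:R) = (24 * p * 2 ^ k)%:R * delta.
    by rewrite (natrM _ _ (2 ^ k)) !natrM; ring.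
  exact: lexx.
exists U2; split.
- exact: subset_trans sU2 sU1.
- rewrite expnS -mulnA mulnC -mulnA (mulnC _ 2); apply: leq_trans cU1.
  by rewrite leq_mul2l cU2 orbT.
move=> i; have := hU2 i; rewrite -!scaler_sumr scalerA -natrM -expnS => h2.
have := opclose_trans h2 (hU1 i).
have -> : f + 3%:R * f = 3%:R * e by rewrite /f; field.
by apply.
Qed.

End Halving.

(** * Size of simultaneous codes *)

Section SimultaneousCodes.
Context {R : realType}.
Local Notation C := R[i].

(** The eigenvalues of a positive operator lie between 0 and its trace. *)
Lemma psdmx_sqr_le n (A : 'M[C]_n) (c : C) : psdmx A -> \tr A <= c ->
  psdmx (c *: A - A ^+ 2).
Proof.
move=> hA htr; have [U [x [U1 U2 xr eA]]] := herm_spectral (psdmx_herm hA).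
have x0 : forall j, 0 <= x 0 j by rewrite eA in hA; exact: psdmx_eigen_ge0 U1 hA.
have xc j : x 0 j <= c.
  apply: le_trans htr; rewrite -[A]expr1 eA tr_expmx_spectral // (bigD1 j) //=.
  by rewrite expr1 lerDl; apply: sumr_ge0 => k _; rewrite expr1.
have -> : c *: A - A ^+ 2 =
    adjmx U *m diag_mx (c *: x - map_mx (fun z => z ^+ 2) x) *m U.
  rewrite raddfB /= linearZ /= mulmxBr mulmxBl -scalemxAr -scalemxAl -eA; congr (_ - _).
  by rewrite eA expmx_spectral.
apply: psdmx_spectral => j; rewrite !mxE expr2 -mulrBl mulr_ge0 //.
by rewrite subr_ge0.
Qed.

(* Each E t is cut into equal copies of trace at most d / Q. *)
Lemma povm_split d T (E : 'I_T -> 'M[C]_d) Q : (0 < d)%N -> (0 < Q)%N -> (T <= Q)%N ->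
  povm E -> exists (T' : finType) (A : T' -> 'M[C]_d) (f : T' -> 'I_T),
  [/\ forall u, psdmx (A u),
      forall u, psdmx ((d%:R / Q%:R) *: A u - A u ^+ 2),
      (#|T'| <= 2 * Q)%N &
      forall S : {set 'I_T}, \sum_(t in S) E t = \sum_(u in f @^-1: S) A u].
Proof.
move=> d0 Q0 TQ [E0 E1].
have dC : 0 < d%:R :> C by rewrite ltr0n.
have QC : 0 < Q%:R :> C by rewrite ltr0n.
have trE : \sum_t \tr (E t) = d%:R by rewrite -raddf_sum /= E1 mxtrace1.
have tr0 t : 0 <= \tr (E t) by exact: psdmx_tr_ge0.
(* The least such m is the number of copies of E_t. Minimality gives d m <= Q Tr E_t + d, and
   summing over t bounds the number of copies by Q + T <= 2 Q. A zero operator still gets one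
   copy. *)
pose P t m := (0 < m)%N && (\tr (E t) * Q%:R <= d%:R * m%:R).
have exP t : exists m, P t m.
  exists Q; rewrite /P Q0 ler_wpM2r ?ler0n // -trE (bigD1 t) //= lerDl.
  by apply: sumr_ge0.
pose m t := ex_minn (exP t).
have [m0 mE mlt] : [/\ forall t, (0 < m t)%N,
    forall t, \tr (E t) * Q%:R <= d%:R * (m t)%:R &
    forall t, d%:R * (m t)%:R <= \tr (E t) * Q%:R + d%:R].
  split=> t; rewrite /m; case: ex_minnP => k /andP[k0 hk] kmin //.
  case: k k0 hk kmin => // -[|k] _ hk kmin.
    by rewrite mulr1 lerDr mulr_ge0.
  rewrite -natr1 mulrDr mulr1 lerD2r ltW // real_ltNge ?realM ?ger0_real ?ler0n //.
  by apply/negP => h; have := kmin k.+1; rewrite /P h /= ltnn => /(_ isT).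
pose T' : finType := {t : 'I_T & 'I_(m t)}.
exists T', (fun u => (m (tag u))%:R^-1 *: E (tag u)), (fun u => tag u).
have mC t : 0 < (m t)%:R :> C by rewrite ltr0n.
split.
- by move=> u; apply: psdmxZ; rewrite ?invr_ge0 ?ler0n.
- move=> u; apply: psdmx_sqr_le; first by apply: psdmxZ; rewrite ?invr_ge0 ?ler0n.
  rewrite mxtraceZ mulrC ler_pdivrMr // mulrAC ler_pdivlMr //.
- rewrite -(@ler_nat C) -(ler_pM2l dC) card_tagged sumnE big_map big_enum /= natr_sum mulr_sumr.
  under eq_bigr do rewrite card_ord.
  apply: (le_trans (ler_sum _ (fun t _ => mlt t))).
  rewrite big_split /= -mulr_suml trE sumr_const card_ord -[X in _ + X]mulr_natr -mulrDr.
  by rewrite ler_wpM2l ?ler0n // -natrD ler_nat mul2n -addnn leq_add2l.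
move=> S; rewrite (eq_bigl (fun u : T' => (tag u \in S) && true)); last first.
  by move=> u; rewrite inE andbT.
rewrite -(sig_big_dep _ (fun t (_ : 'I_(m t)) => true) (fun t _ => (m t)%:R^-1 *: E t)) /=.
apply: eq_bigr => t _; rewrite sumr_const card_ord -scaler_nat scalerA divff ?scale1r //.
by rewrite gt_eqF.
Qed.

(** A subset with at most M elements is listed by a word of length M over U, padded with [None];
    hence the base |U| + 1. *)
Lemma card_small_subsets (T : finType) (U : {set T}) M :
  (#|[set W : {set T} | (W \subset U) && (#|W| <= M)%N]| <= (#|U|).+1 ^ M)%N.
Proof.
pose D := None |: [set Some x | x in U].
pose phi (f : {ffun 'I_M -> option T}) := [set x : T | [exists i, f i == Some x]].
have cD : #|D| = #|U|.+1.
  rewrite cardsU1 card_imset; last by move=> x y [].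
  by case: imsetP => [[]|].
rewrite -cD -[X in (_ ^ X)%N]card_ord -card_ffun_on -[X in (_ <= X)%N]cardsE.
apply: leq_trans (leq_imset_card phi _); apply: subset_leq_card.
apply/subsetP => W; rewrite inE => /andP[WU WM].
pose f := [ffun i : 'I_M => nth None (map Some (enum W)) i].
apply/imsetP; exists f.
  rewrite inE; apply/ffun_onP => i; rewrite ffunE.
  case: (ltnP i (size (map Some (enum W)))) => hi; last by rewrite nth_default // !inE eqxx.
  have /mapP[x xW ->] := mem_nth None hi.
  rewrite !inE; apply/imsetP; exists x => //; apply: (subsetP WU).
  by rewrite mem_enum in xW.
apply/setP => x; rewrite inE; apply/idP/existsP => [xW|].
  have hx : (index x (enum W) < M)%N.
    by apply: leq_trans WM; rewrite cardE index_mem mem_enum.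
  exists (Ordinal hx); rewrite ffunE /= (nth_map x) ?index_mem ?mem_enum //.
  by rewrite nth_index // mem_enum.
case=> i; rewrite ffunE => /eqP h.
have hi : (i < size (map Some (enum W)))%N.
  by case: ltnP => // hi; move: h; rewrite nth_default.
by have := mem_nth None hi; rewrite h => /mapP[y yW]; case=> ->; rewrite mem_enum in yW.
Qed.

Lemma povm_setC d T (E : 'I_T -> 'M[C]_d) (S : {set 'I_T}) : povm E ->
  1%:M - \sum_(t in S) E t = \sum_(t in ~: S) E t.
Proof.
case=> _ <-; apply/eqP; rewrite subr_eq (bigID (fun t => t \in S)) addrC /=.
by apply/eqP; congr (_ + _); apply: eq_bigl => t; rewrite inE.
Qed.

(** Two stages. After splitting the POVM into at most 2 Q operators, T halvings with moment
    parameter p 2^k preserve all N decoding operators and leave at most 48 g^2 d p 2^k elements. For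
    each i separately, k more halvings with parameter p leave at most 48 g^2 d p of these. The total
    error is 6/g per operator, so the surviving part of S_i determines i, and N is at most the
    number of small subsets. *)
Lemma simultaneous_code_bound d N T (rho : 'I_N -> 'M[C]_d) (E : 'I_T -> 'M[C]_d)
    (S : 'I_N -> {set 'I_T}) (a b : C) g p k :
  (0 < d)%N -> (2 < g)%N -> (0 < p)%N -> (d <= 2 ^ p)%N -> (N * d <= 2 ^ (p * 2 ^ k))%N ->
  (forall i, state (rho i)) -> povm E ->
  (forall i, a <= \tr (rho i *m \sum_(t in S i) E t)) ->
  (forall i j, i != j -> \tr (rho i *m \sum_(t in S j) E t) <= b) ->
  b + 12%:R / g%:R < a ->
  (N <= (48 * g ^ 2 * d * p * 2 ^ k).+1 ^ (48 * g ^ 2 * d * p))%N.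
Proof.
move=> d0 g2 p0 dp Nd hrho hE ha hb hab.
have g0 : (0 < g)%N by apply: leq_trans g2.
(* [Q] is chosen so that delta = d / Q satisfies 24 p1 2^T delta = 1 / g^2, as T halvings with e = 1
   / g require. The factor 2^T also ensures T <= Q. *)
pose p1 := (p * 2 ^ k)%N; pose Q := (24 * p1 * g ^ 2 * d * 2 ^ T)%N.
have p10 : (0 < p1)%N by rewrite muln_gt0 p0 expn_gt0.
have Q0 : (0 < Q)%N by rewrite !muln_gt0 /= p0 d0 !expn_gt0 g0.
have TQ : (T <= Q)%N.
  apply: leq_trans (ltnW (ltn_expl T (ltnSn 1))) _; rewrite leq_pmull //.
  by rewrite !muln_gt0 /= p0 d0 !expn_gt0 g0.
have [T' [A [f [A0 A2 cT' eA]]]] := povm_split d0 Q0 TQ hE.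
pose e : C := g%:R^-1.
have e0 : 0 <= e by rewrite invr_ge0 ler0n.
have gC : g%:R != 0 :> C by rewrite pnatr_eq0 -lt0n.
have e1 : 3%:R * e <= 1 by rewrite ler_pdivrMr ?ltr0n // mul1r ler_nat.
have dC : d%:R != 0 :> C by rewrite pnatr_eq0 -lt0n.
have pC : p%:R != 0 :> C by rewrite pnatr_eq0 -lt0n.
have t2C m : (2 ^ m)%:R != 0 :> C by rewrite pnatr_eq0 -lt0n expn_gt0.
pose del : C := d%:R / Q%:R.
have del0 : 0 <= del by rewrite mulr_ge0 ?invr_ge0 ?ler0n.
have edel : (24 * p1 * 2 ^ T)%:R * del = e ^+ 2.
  rewrite /del /Q /p1 /e !natrM; field.
  by rewrite gC dC pC !t2C.
pose S' i := f @^-1: S i.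
have hU i : psdmx (2%:R%:M - \sum_(u in S' i :&: setT) A u).
  rewrite setIT -eA.
  have -> : 2%:R%:M - \sum_(t in S i) E t = 1%:M + \sum_(t in ~: S i) E t.
    by rewrite [2%:R]mulr2n raddfD /= -addrA povm_setC.
  apply: psdmxD; first exact: psdmx1.
  by apply: psdmx_sum => t _; apply: (proj1 hE).
have hI : (#|'I_N| * d <= 2 ^ p1)%N by rewrite card_ord.
have [|U1 [_ cU1 hU1]] := halving_iter (k := T) A0 A2 del0 p10 hI hU e0 e1.
  by rewrite edel.
have cU1' : (#|U1| <= 48 * g ^ 2 * d * p * 2 ^ k)%N.
  rewrite -(@leq_pmul2l (2 ^ T)) ?expn_gt0 //; apply: leq_trans cU1 _.
  rewrite cardsT; apply: leq_trans cT' _; rewrite /Q /p1; apply: eq_leq.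
  by lia.
have ex2 i : exists U2 : {set T'}, [/\ U2 \subset U1, (#|U2| <= 48 * g ^ 2 * d * p)%N &
   opclose (6%:R * e) ((2 ^ k)%:R *: \sum_(u in S' i :&: U2) (2 ^ T)%:R *: A u)
                      (\sum_(t in S i) E t)].
  (* The first stage may have raised the bound 1 to 1 + 3 e <= 2, which is why [halving_iter] starts
     from 2. The index type [unit] expresses that only one operator has to be preserved. *)
  have hU2 (_ : unit) : psdmx (2%:R%:M - \sum_(u in S' i :&: U1) (2 ^ T)%:R *: A u).
    rewrite -scaler_sumr.
    have -> : 2%:R%:M - (2 ^ T)%:R *: \sum_(u in S' i :&: U1) A u =
      (1 - 3%:R * e)%:M + ((1 + 3%:R * e)%:M - (2 ^ T)%:R *: \sum_(u in S' i :&: U1) A u).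
      rewrite addrA -raddfD /=; congr (_%:M - _); ring.
    apply: psdmxD.
      by rewrite -scalemx1; apply: psdmxZ; [rewrite subr_ge0|exact: psdmx1].
    apply: opclose_le (hU1 i) _; rewrite setIT -eA povm_setC //.
    by apply: psdmx_sum => t _; apply: (proj1 hE).
  have hI1 : (#|{: unit}| * d <= 2 ^ p)%N by rewrite card_unit mul1n.
  have del20 : 0 <= (2 ^ T)%:R * del by rewrite mulr_ge0 ?ler0n.
  have [u|u||U2 [sU2 cU2 hU2']] := @halving_iter _ _ T' d (fun u => (2 ^ T)%:R *: A u)
    (fun=> S' i) U1 ((2 ^ T)%:R * del) p k _ _ del20 p0 hI1 hU2 e e0 e1.
  - by apply: psdmxZ; rewrite ?ler0n.
  - have -> : ((2 ^ T)%:R * del) *: ((2 ^ T)%:R *: A u) - ((2 ^ T)%:R *: A u) ^+ 2 =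
       (2 ^ T)%:R ^+ 2 *: (del *: A u - A u ^+ 2).
      rewrite scalerBr !scalerA; congr (_ *: _ - _); first by rewrite mulrAC expr2.
      by rewrite !expr2 -!mulmxE -scalemxAl -scalemxAr scalerA.
    by apply: psdmxZ; [rewrite exprn_ge0 ?ler0n|exact: A2].
  - by rewrite mulrA -natrM -edel /p1 mulnA.
  exists U2; split => //.
    rewrite -(@leq_pmul2l (2 ^ k)) ?expn_gt0 //; apply: leq_trans cU2 _.
    by apply: leq_trans cU1' _; rewrite mulnC.
  have h1 := hU1 i; rewrite scaler_sumr setIT -eA in h1.
  have := opclose_trans (hU2' tt) h1.
  have -> : 3%:R * e + 3%:R * e = 6%:R * e by ring.
  by apply.
have [U2 hU2] := fin_all_exists ex2.
pose W i := S' i :&: U2 i.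
(* If W_i = W_j, then D_i and D_j are both within 6 / g of the same operator, so in the state rho_i
   their expectations differ by at most 12 / g, less than a - b. *)
have Winj : injective W.
  move=> i j Wij; apply/eqP/negP => /negP ij.
  have [_ _ ci] := hU2 i; have [_ _ cj] := hU2 j.
  have [r0 r1] := hrho i.
  have [_ h1] := opclose_tr ci r0 r1; have [h2 _] := opclose_tr cj r0 r1.
  rewrite -/(W i) Wij in h1; rewrite -/(W j) in h2.
  have := lt_le_trans hab (le_trans (ha i) h1).
  have := le_trans h2 (lerD (hb i j ij) (lexx _)).
  rewrite -(lerD2r (6%:R * e)) => h3 h4; have := lt_le_trans h4 h3.
  have -> : b + 6%:R * e + 6%:R * e = b + 12%:R * e by ring.
  by rewrite ltxx.
have -> : N = #|W @: [set: 'I_N]| by rewrite card_imset // cardsT card_ord.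
apply: (@leq_trans #|[set V : {set T'} | (V \subset U1) && (#|V| <= 48 * g ^ 2 * d * p)%N]|).
  apply: subset_leq_card; apply/subsetP => _ /imsetP[i _ ->]; rewrite inE.
  have [s c _] := hU2 i; rewrite (subset_trans (subsetIr _ _) s).
  exact: leq_trans (subset_leq_card (subsetIr _ _)) c.
apply: leq_trans (card_small_subsets _ _) _.
by rewrite leq_exp2r // !muln_gt0 /= g0 d0 p0.
Qed.

(** The parameters that contradict [simultaneous_code_bound] at N = 2^(d n^3). With G = 48 g^2 and p
    = n c, the logarithm of its bound is at most G d p (G + 3 p + 3 n), which is d times O(n^2). *)
Lemma expn_bound_contra c g n : (0 < c)%N ->
  (48 * g ^ 2 * c * (48 * g ^ 2 + 3 * c + 3) < n)%N ->
  let d := (c ^ n)%N in let p := (n * c)%N in let k := (p + 3 * n)%N in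
  [/\ (d <= 2 ^ p)%N, (2 ^ (d * n ^ 3) * d <= 2 ^ (p * 2 ^ k))%N &
  ((48 * g ^ 2 * d * p * 2 ^ k).+1 ^ (48 * g ^ 2 * d * p) < 2 ^ (d * n ^ 3))%N].
Proof.
move=> c0 hn d p k.
have n0 : (0 < n)%N by apply: leq_ltn_trans hn.
have p0 : (0 < p)%N by rewrite muln_gt0 n0.
have d0 : (0 < d)%N by rewrite expn_gt0 c0.
have dp : (d <= 2 ^ p)%N.
  by rewrite /d /p mulnC expnM leq_exp2r // ltnW // ltn_expl.
split => //.
  apply: leq_trans (_ : 2 ^ (d * n ^ 3) * 2 ^ p <= _)%N; first by rewrite leq_mul2l dp orbT.
  rewrite -expnD leq_exp2l // /k expnD.
  (* The summand 3 n of k makes 2^k >= 2^p (n^3 + 1), enough to cover both d n^3 and the logarithm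
     of d. *)
  have h3 : ((n ^ 3).+1 <= 2 ^ (3 * n))%N.
    rewrite [X in (2 ^ X)%N]mulnC expnM -[X in (X < _)%N]/(n ^ 3)%N ltn_exp2r //.
    exact: ltn_expl.
  apply: leq_trans (_ : p * (2 ^ p * (n ^ 3).+1) <= _)%N; last first.
    by rewrite !leq_mul2l h3 !orbT.
  rewrite mulnS mulnDr addnC leq_add //.
    by rewrite leq_pmulr // expn_gt0.
  by rewrite mulnA leq_mul2r (leq_trans dp) ?orbT // leq_pmull.
set G := (48 * g ^ 2)%N in hn *; clearbody G.
have pp : (p <= 2 ^ p)%N by rewrite ltnW // ltn_expl.
have base : ((G * d * p * 2 ^ k).+1 <= 2 ^ (G + (3 * p + 3 * n)))%N.
  apply: leq_trans (_ : G.+1 * (2 ^ p * 2 ^ p * 2 ^ k) <= _)%N; last first.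
    rewrite /k -!expnD [X in (_ <= X)%N]expnD leq_mul //; first exact: ltn_expl.
    by rewrite leq_exp2l //; lia.
  rewrite mulSn -addn1 addnC leq_add //; first by rewrite !muln_gt0 !expn_gt0.
  have -> : (G * (2 ^ p * 2 ^ p * 2 ^ k) = G * 2 ^ p * 2 ^ p * 2 ^ k)%N by rewrite !mulnA.
  by do 3!apply: leq_mul => //.
apply: (@leq_ltn_trans (2 ^ ((G + (3 * p + 3 * n)) * (G * d * p)))%N).
  case: (posnP (G * d * p)%N) => [->|h]; first by rewrite muln0 !expn0.
  by rewrite [X in (_ <= X)%N]expnM leq_exp2r.
rewrite ltn_exp2l //.
have -> : ((G + (3 * p + 3 * n)) * (G * d * p) = d * (n * (G * c * (G + 3 * p + 3 * n))))%N.
  by rewrite /p; lia.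
rewrite ltn_pmul2l // expnS ltn_pmul2l // expnS expn1.
apply: (@leq_ltn_trans (G * c * (G + 3 * c + 3) * n)%N); last by rewrite ltn_pmul2r.
rewrite -[X in (_ <= X)%N]mulnA leq_mul2l; apply/orP; right; rewrite /p.
have : (G <= G * n)%N by rewrite leq_pmulr.
lia.
Qed.

End SimultaneousCodes.

(** * Channels *)

Section Channels.
Context {R : realType}.
Local Notation C := R[i].
Import mxtens.

Definition krausmap (I : finType) a b (K : I -> 'M[C]_(b, a)) (X : 'M[C]_a) : 'M[C]_b :=
  \sum_m K m *m X *m adjmx (K m).

Definition kraus_rep (I : finType) a b (Phi : 'M[C]_a -> 'M[C]_b) (K : I -> 'M[C]_(b, a)) :=
  Phi =1 krausmap K /\ \sum_m adjmx (K m) *m K m = 1%:M.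

Lemma krausmapD (I : finType) a b (K : I -> 'M[C]_(b, a)) X Y :
  krausmap K (X + Y) = krausmap K X + krausmap K Y.
Proof.
by rewrite -big_split; apply: eq_bigr => m _; rewrite mulmxDr mulmxDl.
Qed.

Lemma krausmap_sum (I : finType) a b (K : I -> 'M[C]_(b, a)) (J : finType) (F : J -> 'M[C]_a) :
  krausmap K (\sum_j F j) = \sum_j krausmap K (F j).
Proof.
apply: (big_morph _ (@krausmapD _ _ _ K)).
by rewrite /krausmap big1 // => m _; rewrite mulmx0 mul0mx.
Qed.

Lemma krausmapZ (I : finType) a b (K : I -> 'M[C]_(b, a)) c X :
  krausmap K (c *: X) = c *: krausmap K X.
Proof.
by rewrite scaler_sumr; apply: eq_bigr => m _; rewrite -scalemxAr -scalemxAl.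
Qed.

(** The sum on the right is the dual map (Heisenberg picture), which turns effects on the output
    into effects on the input. *)
Lemma tr_krausmap (I : finType) a b (K : I -> 'M[C]_(b, a)) X M :
  \tr (krausmap K X *m M) = \tr (X *m \sum_m adjmx (K m) *m M *m K m).
Proof.
rewrite mulmx_suml mulmx_sumr !raddf_sum; apply: eq_bigr => m _ /=.
by rewrite -!mulmxA mxtrace_mulC -!mulmxA.
Qed.

Lemma krausmap_psd (I : finType) a b (K : I -> 'M[C]_(b, a)) X :
  psdmx X -> psdmx (krausmap K X).
Proof.
move=> hX; apply: psdmx_sum => m _.
by have := psdmx_congr (adjmx (K m)) hX; rewrite adjmxK.
Qed.

Lemma delta_entry a (i j p q : 'I_a) :
  (delta_mx i j : 'M[C]_a) p q = ((p == i) && (q == j))%:R.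
Proof. by rewrite mxE. Qed.

Lemma sum_delta2 a (F : 'I_a -> 'I_a -> C) p q :
  \sum_i \sum_j F i j * (delta_mx i j : 'M[C]_a) p q = F p q.
Proof.
rewrite (bigD1 p) //= (bigD1 q) //= delta_entry !eqxx mulr1.
rewrite !big1 ?addr0 // => [i ip|j jq].
  by rewrite big1 // => j _; rewrite delta_entry eq_sym (negPf ip) mulr0.
by rewrite delta_entry [q == j]eq_sym (negPf jq) andbF mulr0.
Qed.

Lemma tensmap_id a a' (X : 'M[C]_(a * a')) :
  tensmap (id : 'M[C]_a -> 'M[C]_a) (id : 'M[C]_a' -> 'M[C]_a') X = X.
Proof.
apply/matrixP => p q.
case: (mxtens_indexP p) => p1 p2; case: (mxtens_indexP q) => q1 q2.
rewrite summxE -[RHS](sum_delta2 (fun i j => X (mxtens_index (i, p2)) (mxtens_index (j, q2)))).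
apply: eq_bigr => i _; rewrite summxE; apply: eq_bigr => j _; rewrite summxE.
rewrite -(sum_delta2 (fun k l => X (mxtens_index (i, k)) (mxtens_index (j, l)))) mulr_suml.
apply: eq_bigr => k _; rewrite summxE mulr_suml; apply: eq_bigr => l _.
by rewrite mxE tensmxE -mulrA; congr (_ * _); rewrite mulrC.
Qed.

Lemma tensmapEl a a' b' (Psi : 'M[C]_a' -> 'M[C]_b') (X : 'M[C]_(a * a')) p1 p2 q1 q2 :
  tensmap (id : 'M[C]_a -> 'M[C]_a) Psi X (mxtens_index (p1, p2)) (mxtens_index (q1, q2)) =
  \sum_k \sum_l X (mxtens_index (p1, k)) (mxtens_index (q1, l)) * Psi (delta_mx k l) p2 q2.
Proof.
rewrite summxE -[RHS](sum_delta2 (fun i j => \sum_k \sum_l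
  X (mxtens_index (i, k)) (mxtens_index (j, l)) * Psi (delta_mx k l) p2 q2)).
apply: eq_bigr => i _; rewrite summxE; apply: eq_bigr => j _; rewrite summxE mulr_suml.
apply: eq_bigr => k _; rewrite summxE mulr_suml; apply: eq_bigr => l _.
by rewrite mxE tensmxE -mulrA; congr (_ * _); rewrite mulrC.
Qed.

Lemma eq_tensmap a b a' b' (Phi Phi' : 'M[C]_a -> 'M[C]_b) (Psi Psi' : 'M[C]_a' -> 'M[C]_b') :
  Phi =1 Phi' -> Psi =1 Psi' -> tensmap Phi Psi =1 tensmap Phi' Psi'.
Proof.
move=> h h' X; apply: eq_bigr => i _; apply: eq_bigr => j _; apply: eq_bigr => k _.
by apply: eq_bigr => l _; rewrite h h'.
Qed.

Lemma ntensmap_idchan d n : ntensmap (idchan R d) (n := n) =1 id.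
Proof.
case: n => [//|n] /=; elim: n => [//|n IH] X /=.
rewrite (eq_tensmap (Phi' := id) (Psi' := id)) //; exact: tensmap_id.
Qed.

(* Kraus operators are read off a spectral decomposition of the Choi matrix. *)
Lemma cptp_kraus a b (Phi : {linear 'M[C]_a -> 'M[C]_b}) : cptp Phi ->
  exists (I : finType) (K : I -> 'M[C]_(b, a)), kraus_rep Phi K.
Proof.
case=> hcp htp.
(* The unnormalised maximally entangled vector, the sum of all e_i ⊗ e_i; it makes [J] the Choi
   matrix of [Phi]. *)
pose w : 'cV[C]_(a * a) :=
  \col_p ((mxtens_unindex p).1 == (mxtens_unindex p).2)%:R.
have hJ : psdmx (tensmap (id : 'M[C]_a -> 'M[C]_a) Phi (w *m adjmx w)).
  apply: hcp; have := psdmx_congr (adjmx w) (@psdmx1 R 1).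
  by rewrite adjmxK mulmx1.
set J := tensmap _ _ _ in hJ.
have JE i j p q : J (mxtens_index (i, p)) (mxtens_index (j, q)) = Phi (delta_mx i j) p q.
  rewrite /J tensmapEl -[RHS](sum_delta2 (fun k l => Phi (delta_mx k l) p q)).
  apply: eq_bigr => k _; apply: eq_bigr => l _; rewrite mulrC; congr (_ * _).
  rewrite mxE big_ord1 adjmxE !mxE !mxtens_indexK /= rmorph_nat -natrM mulnb.
  by [].
have [U [x [U1 U2 xr eJ]]] := herm_spectral (psdmx_herm hJ).
have x0 : forall m, 0 <= x 0 m by rewrite eJ in hJ; exact: psdmx_eigen_ge0 U1 hJ.
(* An eigenvector of the Choi matrix, reshaped as a b by a matrix and scaled by the root of its
   eigenvalue. *)
pose K (m : 'I_(a * b)) : 'M[C]_(b, a) :=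
  \matrix_(p, i) (sqrtC (x 0 m) * (U m (mxtens_index (i, p)))^*%R).
have KE : Phi =1 krausmap K.
  move=> X; apply/matrixP => p q; rewrite summxE {1}(matrix_sum_delta X).
  rewrite linear_sum summxE [RHS](eq_bigr (fun m => \sum_i \sum_j
     X i j * (x 0 m * ((U m (mxtens_index (i, p)))^*%R * U m (mxtens_index (j, q)))))).
    rewrite exchange_big /=; apply: eq_bigr => i _.
    rewrite linear_sum summxE exchange_big /=; apply: eq_bigr => j _.
    rewrite linearZ mxE -JE eJ -mulr_sumr; congr (_ * _).
    rewrite mul_mx_diag mxE; apply: eq_bigr => m _; rewrite !mxE.
    by rewrite mulrCA mulrA.
  move=> m _; rewrite mxE exchange_big /=; apply: eq_bigr => j _.
  rewrite mxE mulr_suml; apply: eq_bigr => i _.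
  rewrite adjmxE !mxE rmorphM /= conjCK.
  have -> : (sqrtC (x 0 m))^*%R = sqrtC (x 0 m).
    by apply/CrealP; rewrite ger0_real // sqrtC_ge0.
  rewrite -[in RHS](sqrtCK (x 0 m)) expr2; ring.
exists 'I_(a * b), K; split => //.
(* Trace preservation on the matrix unit [delta_mx j i] yields the entry (i, j) of the completeness
   relation. *)
apply/matrixP => i j.
have := htp (delta_mx j i); rewrite KE -[krausmap K _]mulmx1 tr_krausmap.
have trd (M : 'M[C]_a) : \tr (delta_mx j i *m M) = M i j.
  rewrite /mxtrace (bigD1 j) //= big1 ?addr0 => [|k kj].
    rewrite mxE (bigD1 i) //= big1 ?addr0; first by rewrite delta_entry !eqxx mul1r.
    by move=> k ki; rewrite delta_entry (negPf ki) andbF mul0r.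
  by rewrite mxE big1 // => l _; rewrite delta_entry (negPf kj) mul0r.
rewrite trd -[delta_mx j i]mulmx1 trd => <-.
by congr (fun_of_matrix _ i j); apply: eq_bigr => m _; rewrite mulmx1.
Qed.

Lemma adjmx_tens m n p q (A : 'M[C]_(m, n)) (B : 'M[C]_(p, q)) :
  adjmx (tensmx A B) = tensmx (adjmx A) (adjmx B).
Proof. by apply/matrixP => i j; rewrite !mxE rmorphM. Qed.

Lemma tensmx_sum (I J : finType) m n p q (A : I -> 'M[C]_(m, n)) (B : J -> 'M[C]_(p, q)) :
  tensmx (\sum_i A i) (\sum_j B j) = \sum_(ij : I * J) tensmx (A ij.1) (B ij.2).
Proof.
apply/matrixP => r s; rewrite -(pair_bigA _ (fun i j => tensmx (A i) (B j))) /=.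
rewrite mxE !summxE mulr_suml; apply: eq_bigr => i _.
by rewrite summxE mulr_sumr; apply: eq_bigr => j _; rewrite mxE.
Qed.

Lemma tensmap_kraus (I J : finType) a b a' b' (Phi : 'M[C]_a -> 'M[C]_b)
    (Psi : 'M[C]_a' -> 'M[C]_b') (K : I -> 'M[C]_(b, a)) (L : J -> 'M[C]_(b', a')) :
  kraus_rep Phi K -> kraus_rep Psi L ->
  kraus_rep (tensmap Phi Psi) (fun ij : I * J => tensmx (K ij.1) (L ij.2)).
Proof.
move=> [hK K1] [hL L1]; split => [X|]; last first.
  rewrite (eq_bigr (fun ij : I * J =>
    tensmx (adjmx (K ij.1) *m K ij.1) (adjmx (L ij.2) *m L ij.2))).
    rewrite -(tensmx_sum (fun i => adjmx (K i) *m K i) (fun j => adjmx (L j) *m L j)) K1 L1.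
    apply/matrixP => p q; case: (mxtens_indexP p) => p1 p2; case: (mxtens_indexP q) => q1 q2.
    by rewrite tensmxE !mxE -natrM mulnb (can_eq (@mxtens_indexK _ _)) xpair_eqE.
  by move=> [i j] _; rewrite adjmx_tens tensmx_mul.
(* Expanding [X] into tensor products of matrix units reduces the claim to a product of two Kraus
   forms. *)
rewrite -[in RHS](tensmap_id X) /tensmap.
rewrite krausmap_sum; apply: eq_bigr => i _; rewrite krausmap_sum; apply: eq_bigr => j _.
rewrite krausmap_sum; apply: eq_bigr => k _; rewrite krausmap_sum; apply: eq_bigr => l _.
rewrite krausmapZ; congr (_ *: _); rewrite hK hL tensmx_sum; apply: eq_bigr => -[m n] _ /=.
by rewrite adjmx_tens -!tensmx_mul.
Qed.

Lemma ntensmap_kraus a b (Phi : {linear 'M[C]_a -> 'M[C]_b}) n : cptp Phi ->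
  exists (I : finType) (K : I -> 'M[C]_(b ^ n, a ^ n)), kraus_rep (ntensmap Phi (n := n)) K.
Proof.
move=> /cptp_kraus [I [K hK]]; case: n => [|n].
  exists unit, (fun=> 1%:M); split => [X|].
    by rewrite /krausmap (big_pred1 tt) ?adjmx1 ?mulmx1 ?mul1mx //; case.
  by rewrite (big_pred1 tt) ?adjmx1 ?mulmx1 //; case.
elim: n => [|n [J [L hL]]]; first by exists I, K.
by exists (I * J)%type, (fun ij => tensmx (K ij.1) (L ij.2)); exact: tensmap_kraus.
Qed.

(** If |A| is the minimum, the POVM is pulled back by the dual map, which is unital and keeps sums
    over subsets; if |B| is the minimum, the states are replaced by their outputs. Both give a
    simultaneous code in dimension c^n. *)
Lemma simultaneous_code_lt a b (Phi : {linear 'M[C]_a -> 'M[C]_b}) (l1 l2 : R) g n N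
    (rho : 'I_N -> 'M[C]_(a ^ n)) (D : 'I_N -> 'M[C]_(b ^ n)) :
  (0 < a)%N -> (0 < b)%N -> cptp Phi -> (2 < g)%N -> l2 + 12%:R / g%:R < 1 - l1 ->
  let c := minn a b in (48 * g ^ 2 * c * (48 * g ^ 2 + 3 * c + 3) < n)%N ->
  id_code (ntensmap Phi (n := n)) l1 l2 rho D -> simultaneous D ->
  (N < 2 ^ (c ^ n * n ^ 3))%N.
Proof.
move=> a0 b0 hPhi g2 hg c hn [hrho _ h1 h2] [T [E [S [hE eD]]]].
have c0 : (0 < c)%N by rewrite leq_min a0.
have ec : c = a \/ c = b by rewrite /c; case: leqP; [left|right].
clearbody c.
have [dp Ndp Nlt] := expn_bound_contra c0 hn.
have n0 : (0 < n)%N by apply: leq_ltn_trans hn.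
have p0 : (0 < n * c)%N by rewrite muln_gt0 n0.
have [I [K [hK K1]]] := ntensmap_kraus n hPhi.
rewrite ltnNge; apply/negP => hN; move: Nlt; apply/negP; rewrite -leqNgt.
(* Only 2^(c^n n^3) codewords are kept, the size to which [expn_bound_contra] applies. *)
pose w i := widen_ord hN i.
have winj i j : i != j -> w i != w j by rewrite -!val_eqE.
have hab : (l2%:C + 12%:R / g%:R < (1 - l1)%:C)%C.
  have -> : (12%:R / g%:R = (12%:R / g%:R : R)%:C :> C)%C.
    by rewrite rmorphM fmorphV !rmorph_nat.
  by rewrite -rmorphD ltcR.
case: ec => ec; subst c.
- pose F t := \sum_m adjmx (K m) *m E t *m K m.
  have FS (A : {set 'I_T}) : \sum_(t in A) F t = \sum_m adjmx (K m) *m (\sum_(t in A) E t) *m K m.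
    rewrite exchange_big /=; apply: eq_bigr => m _.
    by rewrite mulmx_sumr mulmx_suml.
  have hF : povm F.
    split=> [t|]; first by apply: psdmx_sum => m _; apply/psdmx_congr/(proj1 hE).
    rewrite -K1 exchange_big /=; apply: eq_bigr => m _.
    by rewrite -mulmx_suml -mulmx_sumr (proj2 hE) mulmx1.
  apply: (@simultaneous_code_bound _ _ _ _ (fun i => rho (w i)) F (fun i => S (w i))
    (1 - l1)%:C%C l2%:C%C g _ _ _ g2 _ dp Ndp _ hF) => //.
  + by rewrite expn_gt0 a0.
  + by move=> i; rewrite FS -tr_krausmap -hK -eD.
  + by move=> i j ij; rewrite FS -tr_krausmap -hK -eD; apply: h2; apply: winj.
- apply: (@simultaneous_code_bound _ _ _ _ (fun i => ntensmap Phi (n := n) (rho (w i))) E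
    (fun i => S (w i)) (1 - l1)%:C%C l2%:C%C g _ _ _ g2 _ dp Ndp _ hE) => //.
  + by rewrite expn_gt0 b0.
  + move=> i; rewrite hK; have [r0 r1] := hrho (w i); split; first exact: krausmap_psd.
    rewrite -[krausmap _ _]mulmx1 tr_krausmap -[RHS]r1 -[in RHS](mulmx1 (rho (w i))) -K1.
    by congr (\tr (_ *m _)); apply: eq_bigr => m _; rewrite mulmx1.
  + by move=> i; rewrite -eD.
  + by move=> i j ij; rewrite -eD; apply: h2; apply: winj.
Qed.

End Channels.

(** * Codes over the noiseless channel *)

Section IndependentSets.

(* Since the in-degrees inside W have the same sum as the out-degrees, some vertex of W
   has in-degree at most D, so that deleting its neighbours costs at most 2 D vertices. *)
Lemma digraph_independent_seq (T : finType) (bad : rel T) D :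
  (forall x, (#|[set y | bad x y]| <= D)%N) ->
  forall k (W : {set T}), (k * (2 * D).+1 <= #|W|)%N ->
  exists s : seq T, [/\ size s = k, {subset s <= W} &
    pairwise (fun x y => ~~ bad x y && ~~ bad y x) s].
Proof.
move=> hD; elim=> [|k IH] W hW; first by exists [::].
have W0 : (0 < #|W|)%N by apply: leq_trans hW; rewrite mulSn.
have [x xW hx] : exists2 x, x \in W & (#|[set y in W | bad y x]| <= D)%N.
  apply/exists_inP; apply: contraLR W0 => /exists_inPn h; rewrite -leqNgt leqn0.
  have le1 : (\sum_(x in W) D.+1 <= \sum_(x in W) #|[set y in W | bad y x]|)%N.
    by apply: leq_sum => x xW; rewrite ltnNge h.
  have le2 : (\sum_(x in W) #|[set y in W | bad y x]| <= \sum_(x in W) D)%N.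
    rewrite (eq_bigr (fun x => \sum_(y in W) (bad y x : nat))) => [|x xW]; last first.
      by rewrite -sum1dep_card big_mkcondr.
    rewrite exchange_big /=; apply: leq_sum => y yW; apply: leq_trans (hD y).
    rewrite -big_mkcondr sum1dep_card; apply: subset_leq_card.
    by apply/subsetP => z; rewrite !inE => /andP[].
  have := leq_trans le1 le2; rewrite !sum_nat_const mulnS => h3.
  by rewrite -leqn0; move: h3; lia.
pose W' := W :\: ([set y | bad x y] :|: [set y in W | bad y x]).
have [|s [szs sW ps]] := IH W'.
  have h1 := cardsID ([set y | bad x y] :|: [set y in W | bad y x]) W.
  have h2 : (#|W :&: ([set y | bad x y] :|: [set y in W | bad y x])| <= D + D)%N.
    apply: leq_trans (subset_leq_card (subsetIr _ _)) _.
    by apply: leq_trans (leq_card_setU _ _) _; apply: leq_add.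
  by move: h1 h2 hW; rewrite -/W' mulSn; lia.
exists (x :: s); split => /=; first by rewrite szs.
  move=> y; rewrite inE => /predU1P[-> //|/sW]; by rewrite inE => /andP[].
rewrite ps andbT; apply/allP => y /sW; rewrite !inE negb_or => /andP[/andP[-> h] yW].
by move: h; rewrite yW.
Qed.

Lemma digraph_independent (T : finType) (bad : rel T) D k :
  (forall x, (#|[set y | bad x y]| <= D)%N) -> (k * (2 * D).+1 <= #|T|)%N ->
  exists f : 'I_k -> T, forall i j, i != j -> ~~ bad (f i) (f j).
Proof.
move=> hD; rewrite -cardsT => /(digraph_independent_seq hD)[s [szs _ ps]].
case: k szs => [|k] szs; first by exists (fun i : 'I_0 => False_rect T (notF (ltn_ord i))); case.
case: s szs ps => // x0 s szs ps; set t := x0 :: s in szs ps.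
exists (fun i => nth x0 t i) => i j ij.
have hp := pairwiseP x0 ps.
have hi : (i : nat) \in gtn (size t) by rewrite szs inE.
have hj : (j : nat) \in gtn (size t) by rewrite szs inE.
case: (ltngtP i j) => h.
- by have /andP[] := hp _ _ hi hj h.
- by have /andP[] := hp _ _ hj hi h.
- by move: ij; rewrite -val_eqE /= h eqxx.
Qed.

Lemma card_bigcup_leq (I T : finType) (P : pred I) (B : I -> {set T}) :
  (#|\bigcup_(i | P i) B i| <= \sum_(i | P i) #|B i|)%N.
Proof.
apply: (big_ind2 (fun (A : {set T}) m => (#|A| <= m)%N)); rewrite ?cards0 //.
by move=> A m A' m' h h'; apply: leq_trans (leq_card_setU _ _) (leq_add h h').
Qed.

(** Once the agreement set is A, the function g is determined by its restriction to the complement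
    of A. *)
Lemma card_agree (X Y : finType) (f : {ffun X -> Y}) (A : {set X}) :
  (#|[set g : {ffun X -> Y} | [set x | f x == g x] == A]| <= #|Y| ^ (#|X| - #|A|))%N.
Proof.
pose r (g : {ffun X -> Y}) : {ffun {x | x \in ~: A} -> Y} := [ffun x => g (val x)].
have -> : (#|Y| ^ (#|X| - #|A|) = #|{: {ffun {x | x \in ~: A} -> Y}}|)%N.
  by rewrite card_ffun card_sig -(cardsC A) addKn.
rewrite -(@card_in_imset _ _ r); first exact: max_card.
move=> g h; rewrite !inE => /eqP gA /eqP hA rgh; apply/ffunP => x.
case: (boolP (x \in A)) => xA.
  have := xA; rewrite -{1}gA inE => /eqP <-.
  by have := xA; rewrite -{1}hA inE => /eqP.
have xA' : x \in ~: A by rewrite inE.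
by have /ffunP/(_ (exist _ x xA')) := rgh; rewrite !ffunE.
Qed.

(** Let K = 2 h. At most 2^(2tK - 2K) functions agree with f exactly on a given set of more than K /
    t points, and there are at most 2^K such sets. The out-degrees are thus at most 2^(2tK - K),
    which leaves room for 2^(K - 2) >= 2^h independent functions. *)
Lemma agreement_code h t : (1 < h)%N -> (0 < t)%N ->
  exists F : 'I_(2 ^ h) -> {ffun 'I_(2 * h) -> 'I_(2 ^ (2 * t))},
  forall i j, i != j -> (t * #|[set x | F i x == F j x]| <= 2 * h)%N.
Proof.
move=> h1 t0; set K := (2 * h)%N; set s := (2 * t)%N.
pose bad (f g : {ffun 'I_K -> 'I_(2 ^ s)}) := (K < t * #|[set x | f x == g x]|)%N.
have hD f : (#|[set g | bad f g]| <= 2 ^ (s * K - K))%N.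
  rewrite (_ : [set g | bad f g] = \bigcup_(A : {set 'I_K} | (K < t * #|A|)%N)
      [set g : {ffun 'I_K -> 'I_(2 ^ s)} | [set x | f x == g x] == A]); last first.
    apply/setP => g; rewrite inE; apply/idP/bigcupP => [b|[A hA]].
      by exists [set x | f x == g x]; rewrite ?inE.
    by rewrite inE /bad => /eqP ->.
  apply: leq_trans (card_bigcup_leq _ _) _.
  apply: (@leq_trans (\sum_(A : {set 'I_K} | (K < t * #|A|)%N) 2 ^ (s * K - 2 * K))%N).
    apply: leq_sum => A hA; apply: leq_trans (card_agree f A) _.
    rewrite !card_ord -expnM leq_exp2l // mulnBr leq_sub2l //.
    by rewrite /s -mulnA leq_mul2l ltnW // orbT.
  rewrite sum_nat_const.
  apply: (@leq_trans (2 ^ K * 2 ^ (s * K - 2 * K))%N).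
    rewrite leq_mul2r; apply/orP; right; apply: leq_trans (max_card _) _.
    by rewrite -cardsT -powersetT card_powerset cardsT card_ord.
  rewrite -expnD leq_exp2l //.
  have : (2 * K <= s * K)%N by rewrite leq_mul2r /s leq_pmulr ?orbT.
  lia.
have [|F hF] := digraph_independent (k := (2 ^ h)%N) hD.
  rewrite card_ffun !card_ord -expnM.
  have e1 : ((2 * 2 ^ (s * K - K)).+1 <= 2 ^ (s * K - K + 2))%N.
    by rewrite expnD -[X in (_ <= _ * X)%N]/4%N; have := expn_gt0 2 (s * K - K); lia.
  apply: leq_trans (leq_mul (leqnn _) e1) _.
  rewrite -expnD leq_exp2l //.
  have : (K <= s * K)%N by rewrite leq_pmull // /s muln_gt0.
  rewrite /K; lia.
by exists F => i j ij; have := hF i j ij; rewrite /bad -leqNgt.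
Qed.

End IndependentSets.

(** * Simultaneous codes from graphs of functions *)

Section ClassicalCodes.
Context {R : realType}.
Local Notation C := R[i].
Import mxtens.

(** Message i is the uniform distribution on S_i, tested by the indicator of S_i: acceptance is
    certain, and confusion has probability |S_i ∩ S_j| / K <= 1 / t. All tests are coarse-grainings
    of the measurement in the standard basis. *)
Lemma diag_simultaneous_code d K (l : R) N (S : 'I_N -> {set 'I_d}) t :
  (0 < K)%N -> (0 < t)%N -> t%:R^-1 <= l ->
  (forall i, #|S i| = K) -> (forall i j, i != j -> (t * #|S i :&: S j| <= K)%N) ->
  exists (rho D : 'I_N -> 'M[C]_d), id_code id l l rho D /\ simultaneous D.
Proof.
move=> K0 t0 tl cS cSS.
have l0 : 0 <= l by apply: le_trans tl; rewrite invr_ge0 ler0n.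
have KC : K%:R != 0 :> C by rewrite pnatr_eq0 -lt0n.
pose chi i : 'rV[C]_d := \row_x (x \in S i)%:R.
pose D i := diag_mx (chi i); pose rho i := K%:R^-1 *: D i.
have tr i j : \tr (rho i *m D j) = K%:R^-1 * #|S i :&: S j|%:R.
  rewrite /rho -scalemxAl mxtraceZ mulmx_diag mxtrace_diag; congr (_ * _).
  rewrite -sum1_card natr_sum [RHS]big_mkcond; apply: eq_bigr => x _.
  by rewrite !mxE inE -natrM mulnb; case: andb.
exists rho, D; split; first split.
- move=> i; split.
    apply: psdmxZ; first by rewrite invr_ge0 ler0n.
    by apply: psdmx_diag => x; rewrite mxE ler0n.
  have := tr i i; rewrite setIid cS mulVf // => <-.
  rewrite /rho -scalemxAl !mxtraceZ; congr (_ * \tr _); rewrite mulmx_diag.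
  congr diag_mx; apply/rowP => x; rewrite !mxE; by case: (_ \in _); rewrite ?mulr1 ?mulr0.
- move=> i; split; first by apply: psdmx_diag => x; rewrite mxE ler0n.
  rewrite -diag_const_mx /D -raddfB; apply: psdmx_diag => x.
  by rewrite !mxE; case: (_ \in _); rewrite ?subrr ?subr0.
- by move=> i; rewrite tr setIid cS mulVf // -[X in _ <= X]/((1 : R)%:C)%C lecR gerBl.
- move=> i j ij; rewrite tr.
  apply: (@le_trans _ _ (t%:R^-1 : R)%:C%C); last by rewrite lecR.
  rewrite fmorphV rmorph_nat ler_pdivrMl ?ltr0n // ler_pdivlMr ?ltr0n //.
  by rewrite -natrM ler_nat mulnC cSS.
exists d, (fun x => delta_mx x x), S; split; last first.
  move=> i; rewrite /D; apply/matrixP => x y; rewrite summxE !mxE.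
  rewrite (eq_bigr (fun z => ((x == z) && (y == z))%:R)) => [|z _]; last by rewrite mxE.
  case: (eqVneq x y) => [<-|xy]; last first.
    by rewrite big1 // => z _; case: eqP => // <-; rewrite eq_sym (negPf xy).
  rewrite big_mkcond (bigD1 x) //= big1 ?addr0 => [|z zx]; last first.
    by rewrite eq_sym (negPf zx) if_same.
  by rewrite eqxx mulr1n; case: (_ \in _).
split.
  move=> x; rewrite (_ : delta_mx x x = diag_mx (delta_mx 0 x)).
    by apply: psdmx_diag => y; rewrite mxE ler0n.
  apply/matrixP => y z; rewrite !mxE eqxx /=.
  case: (eqVneq y z) => [->|yz]; rewrite ?mulr1n ?mulr0n ?andbb //.
  by case: eqP => // <-; rewrite eq_sym (negPf yz).
apply/matrixP => x y; rewrite summxE mxE.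
rewrite (eq_bigr (fun z => ((x == z) && (y == z))%:R)) => [|z _]; last by rewrite mxE.
rewrite (bigD1 x) //= big1 ?addr0 => [|z zx]; last by rewrite [x == z]eq_sym (negPf zx).
by rewrite eqxx eq_sym.
Qed.

(** The 2^n basis vectors are indexed by pairs (x, y) with 2 h values of x and 2^(2t) values of y.
    The sets are the graphs of the functions from [agreement_code], and two graphs meet where the
    functions agree. *)
Lemma id_simultaneous_code_exists (l : R) t n : (0 < t)%N -> t%:R^-1 <= l ->
  (2 * t + 1 < n)%N ->
  exists (rho D : 'I_(2 ^ (2 ^ (n - (2 * t + 1)))) -> 'M[C]_(2 ^ n)),
    id_code (ntensmap (idchan R 2) (n := n)) l l rho D /\ simultaneous D.
Proof.
move=> t0 tl tn; set h := (2 ^ (n - (2 * t + 1)))%N.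
have h1 : (1 < h)%N by rewrite -[1%N]/(2 ^ 0)%N ltn_exp2l // subn_gt0.
have [F hF] := agreement_code h1 t0.
have en : (2 * h * 2 ^ (2 * t) = 2 ^ n)%N.
  by rewrite /h -expnS -expnD; congr (2 ^ _)%N; lia.
pose ix x (y : 'I_(2 ^ (2 * t))) := cast_ord en (mxtens_index (x, y)).
have ixI x y x' y' : ix x y = ix x' y' -> (x, y) = (x', y').
  by move=> /cast_ord_inj /(can_inj (@mxtens_indexK _ _)).
pose S i := [set ix x (F i x) | x : 'I_(2 * h)].
have cS i : #|S i| = (2 * h)%N.
  by rewrite card_imset ?card_ord // => x y /ixI [].
have [|i j ij|rho [D [hc hs]]] := @diag_simultaneous_code (2 ^ n) (2 * h) l _ S t _ t0 tl cS.
- by rewrite muln_gt0 /= ltnW.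
- apply: leq_trans (hF i j ij); rewrite leq_mul2l; apply/orP; right.
  apply: leq_trans (leq_imset_card (fun x => ix x (F i x)) _); apply: subset_leq_card.
  apply/subsetP => z; rewrite inE => /andP[/imsetP[x _ ->] /imsetP[y _ e]].
  apply/imsetP; exists x => //; rewrite inE.
  by have [exy ->] := ixI _ _ _ _ e; rewrite exy.
exists rho, D; split => //; case: hc => a b c e; split => // [i|i j ij].
  by rewrite ntensmap_idchan.
by rewrite ntensmap_idchan; apply: e.
Qed.

End ClassicalCodes.

(** * Exponential moments of quadratic forms in random signs *)

Section RandomSubspaces.
Context {R : realType}.
Local Notation C := R[i].

Lemma sum_split_ffun (V : nmodType) d (F : {ffun 'I_d.+1 -> bool} -> V) :
  \sum_g F g = \sum_(g : {ffun 'I_d -> bool}) \sum_(b : bool)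
    F [ffun i => oapp g b (unlift ord0 i)].
Proof.
rewrite exchange_big pair_bigA /=.
pose h (bg : bool * {ffun 'I_d -> bool}) : {ffun 'I_d.+1 -> bool} :=
  [ffun i => oapp bg.2 bg.1 (unlift ord0 i)].
rewrite (reindex h) //=.
exists (fun g => (g ord0, [ffun i => g (lift ord0 i)])) => [[b g] _|g _] /=.
  rewrite /h ffunE unlift_none /=; congr (_, _).
  by apply/ffunP => i; rewrite !ffunE /= liftK.
by apply/ffunP => i; rewrite ffunE; case: unliftP => [j ->|->] /=; rewrite ?ffunE.
Qed.

Definition qform d (A : 'I_d -> 'I_d -> R) (v : 'I_d -> R) : R :=
  \sum_i \sum_j A i j * (v i * v j).

Definition sgn d (g : {ffun 'I_d -> bool}) (i : 'I_d) : R := (-1) ^+ g i.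

(** A weak form of cosh x <= exp (x^2 / 2). For x^2 > 1 each exponential is bounded separately.
    Otherwise exp y <= (1 - y/2)^(-2), and with u = x^2 / 4 the two bounds add up to 2 (1 + u) / (1
    - u)^2. *)
Lemma cosh_le_expR (x : R) : expR x + expR (- x) <= 2%:R * expR (2%:R * x ^+ 2).
Proof.
have [x2|x2] := lerP (x ^+ 2) 1; last first.
  have h (y : R) : y ^+ 2 = x ^+ 2 -> expR y <= expR (2%:R * x ^+ 2).
    by move=> yx; rewrite ler_expR -yx; rewrite -yx in x2; nra.
  by rewrite mulr_natl mulr2n lerD // h // sqrrN.
pose u := x ^+ 2 / 4%:R.
have u0 : 0 <= u by rewrite mulr_ge0 ?sqr_ge0 ?invr_ge0 ?ler0n.
have u1 : u <= 4%:R^-1 by rewrite ler_piMl // invr_ge0 ler0n.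
have half (y : R) : y < 2%:R -> expR y <= (1 - y / 2%:R) ^- 2.
  move=> y2; have y1 : 0 < 1 - y / 2%:R by lra.
  have e : expR (y / 2%:R) <= (1 - y / 2%:R)^-1.
    by rewrite -[leLHS]invrK lef_pV2 ?posrE ?invr_gt0 ?expR_gt0 // -expRN expR_ge1Dx.
  rewrite {1}(splitr y) expRD -exprVn expr2.
  by apply: ler_pM; rewrite ?expR_ge0.
have xb : -1 <= x <= 1 by rewrite -ler_norml -(@expr_le1 _ 2) // real_normK // num_real.
have h1 : expR x + expR (- x) <= 2%:R * ((1 + u) / (1 - u) ^+ 2).
  apply: le_trans (lerD (half x _) (half (- x) _)) _; try lra.
  have : 1 - x / 2%:R != 0 by apply: lt0r_neq0; lra.
  have : 1 - - x / 2%:R != 0 by apply: lt0r_neq0; lra.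
  have -> : 1 - u = (1 - x / 2%:R) * (1 - - x / 2%:R) by rewrite /u; field.
  have -> : 2%:R * ((1 + u) / ((1 - x / 2%:R) * (1 - - x / 2%:R)) ^+ 2) =
    ((1 - x / 2%:R) ^+ 2 + (1 - - x / 2%:R) ^+ 2) / ((1 - x / 2%:R) * (1 - - x / 2%:R)) ^+ 2.
    by rewrite mulrA; congr (_ / _); rewrite /u; field.
  move: (1 - - x / 2%:R) (1 - x / 2%:R) => q p q0 p0.
  rewrite le_eqVlt; apply/orP; left; apply/eqP; field.
  by rewrite q0 p0.
apply: le_trans h1 _; rewrite ler_pM2l ?ltr0n //.
(* Of the exponent 8 u, one u pays for 1 + u and 2 u for each factor 1 / (1 - u); the remaining 3 u
   is slack. *)
have -> : 2%:R * x ^+ 2 = u + (2%:R * u + 2%:R * u) + 3%:R * u by rewrite /u; field.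
have e1 : 1 + u <= expR u by exact: expR_ge1Dx.
have e2 : (1 - u)^-1 <= expR (2%:R * u).
  apply: le_trans (expR_ge1Dx _); rewrite invf_ple ?posrE; try lra.
  rewrite -[leLHS]div1r ler_pdivrMr; last by lra.
  nra.
rewrite -exprVn [in leRHS]expRD -[leLHS]mulr1; apply: ler_pM => //.
- by rewrite mulr_ge0 ?exprn_ge0 ?invr_ge0 //; lra.
- rewrite 2!expRD expr2; apply: ler_pM => //; rewrite ?mulr_ge0 ?invr_ge0 //; try lra.
  by apply: ler_pM; rewrite ?invr_ge0 //; lra.
- by rewrite -[leLHS]expR0 ler_expR; lra.
Qed.

(* Integrating out one sign replaces the form A by its compression A' plus a rank one
   term; the bounds 0 <= A <= 1/16 survive. *)
Lemma sum_expR_qform d (A : 'I_d -> 'I_d -> R) :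
  (forall i j, A i j = A j i) ->
  (forall v, 0 <= qform A v <= 16%:R^-1 * \sum_i v i ^+ 2) ->
  \sum_(g : {ffun 'I_d -> bool}) expR (qform A (sgn g)) <=
    (2 ^ d)%:R * expR (2%:R * \sum_i A i i).
Proof.
elim: d A => [|d IH] A Asym hA.
  rewrite big_ord0 mulr0 expR0 mulr1 expn0.
  rewrite (eq_bigr (fun=> 1)) => [|g _]; last by rewrite /qform big_ord0 expR0.
  by rewrite sumr_const card_ffun card_ord expn0.
pose al := A ord0 ord0; pose a i := A ord0 (lift ord0 i).
pose A' i j := A (lift ord0 i) (lift ord0 j).
pose lin (v : 'I_d -> R) := \sum_i a i * v i.
pose ext (x : R) (v : 'I_d -> R) i := oapp v x (unlift ord0 i).
have ext0 x v : ext x v ord0 = x by rewrite /ext unlift_none.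
have extS x v i : ext x v (lift ord0 i) = v i by rewrite /ext liftK.
have qe x v : qform A (ext x v) = al * x ^+ 2 + 2%:R * x * lin v + qform A' v.
  rewrite {1}/qform big_ord_recl big_ord_recl ext0 expr2 -/al.
  rewrite (eq_bigr (fun i => x * (a i * v i))) => [|i _]; last by rewrite extS /a; ring.
  rewrite -mulr_sumr -/(lin v).
  rewrite [X in _ + X](eq_bigr
    (fun i => x * (a i * v i) + \sum_j A' i j * (v i * v j))); last first.
    move=> i _; rewrite big_ord_recl ext0 extS Asym -/(a i); congr (_ + _); first by ring.
    by apply: eq_bigr => j _; rewrite !extS.
  rewrite big_split /= -mulr_sumr -/(lin v) -/(qform A' v); ring.
have se x v : \sum_i ext x v i ^+ 2 = x ^+ 2 + \sum_i v i ^+ 2.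
  by rewrite big_ord_recl ext0; congr (_ + _); apply: eq_bigr => i _; rewrite extS.
have al0 : 0 <= al.
  have /andP[+ _] := hA (ext 1 (fun=> 0)); rewrite qe expr1n mulr1.
  rewrite /lin /qform !big1 ?mulr0 ?addr0 // => [i _|i _]; last by rewrite mulr0.
  by rewrite big1 // => j _; rewrite !mulr0.
pose na := \sum_i a i ^+ 2.
(* The form is nonnegative at (1/16, -a), while its compression at -a is at most |a|^2 / 16. *)
have na_le : 16%:R * na <= al.
  have lina : lin (fun i => - a i) = - na.
    by rewrite /lin -sumrN; apply: eq_bigr => i _; rewrite mulrN expr2.
  have /andP[h1 _] := hA (ext 16%:R^-1 (fun i => - a i)).
  have /andP[_ h2] := hA (ext 0 (fun i => - a i)).
  move: h1 h2; rewrite !qe lina se expr0n /= !mulr0 !mul0r !add0r.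
  rewrite (eq_bigr (fun i => a i ^+ 2)) -/na => [|i _]; last by rewrite sqrrN.
  move=> h1 h2.
  have : 0 <= al * 16%:R^-1 ^+ 2 - 16%:R^-1 * na by lra.
  have -> : al * 16%:R^-1 ^+ 2 - 16%:R^-1 * na = 16%:R^-1 ^+ 2 * (al - 16%:R * na) by field.
  by rewrite pmulr_rge0 ?subr_ge0 // exprn_gt0 // invr_gt0 ltr0n.
(* Averaging over the removed sign gives cosh (2 y) <= exp (8 y^2), where y is [lin] of the other
   signs; hence the coefficient 8. *)
pose B i j := A' i j + 8%:R * (a i * a j).
have qB v : qform B v = qform A' v + 8%:R * lin v ^+ 2.
  rewrite expr2 /lin mulr_suml mulr_sumr -big_split /=; apply: eq_bigr => i _.
  rewrite !mulr_sumr -big_split /=; apply: eq_bigr => j _; rewrite /B; ring.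
have hB v : 0 <= qform B v <= 16%:R^-1 * \sum_i v i ^+ 2.
  have /andP[h0 _] := hA (ext 0 v).
  (* At this value of the removed coordinate the upper bound for A leaves room for 16 (lin v)^2,
     more than B adds. *)
  have /andP[_ h1] := hA (ext (16%:R * lin v) v).
  move: h0 h1; rewrite !qe se qB expr0n /= !mulr0 !mul0r !add0r => h0 h1.
  have l2 := sqr_ge0 (lin v); have m := mulr_ge0 al0 l2.
  rewrite !exprMn in h1; apply/andP; split; nra.
have Bsym i j : B i j = B j i by rewrite /B /A' Asym [a i * _]mulrC.
have trB : \sum_i B i i = \sum_i A' i i + 8%:R * na.
  by rewrite big_split /= -mulr_sumr.
have bound (g : {ffun 'I_d -> bool}) :
    \sum_(b : bool) expR (qform A (sgn [ffun i => oapp g b (unlift ord0 i)])) <=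
    2%:R * expR al * expR (qform B (sgn g)).
  have e b : sgn [ffun i => oapp g b (unlift ord0 i)] =1 ext ((-1) ^+ b) (sgn g).
    by move=> i; rewrite /sgn ffunE /ext; case: unlift.
  have qeq b : qform A (sgn [ffun i => oapp g b (unlift ord0 i)]) =
      qform A (ext ((-1) ^+ b) (sgn g)).
    by apply: eq_bigr => i _; apply: eq_bigr => j _; rewrite !e.
  rewrite big_bool /= !qeq !qe !expr0 !expr1 sqrrN !expr1n !mulr1 mulrN1.
  set y := lin (sgn g); set z := qform A' _.
  have -> : al + -2 * y + z = al + z + - (2 * y) by ring.
  have -> : al + 2 * y + z = al + z + 2 * y by ring.
  have -> : qform B (sgn g) = z + 2%:R * (2%:R * y) ^+ 2 by rewrite qB -/z -/y; ring.
  rewrite !expRD.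
  have := cosh_le_expR (2%:R * y).
  move: (expR (2%:R * y)) (expR (- (2%:R * y))) (expR (2%:R * (2%:R * y) ^+ 2)) => E1 E2 E3 hE.
  have -> : expR al * expR z * E2 + expR al * expR z * E1 = expR al * expR z * (E1 + E2) by ring.
  have -> : 2%:R * expR al * (expR z * E3) = expR al * expR z * (2%:R * E3) by ring.
  by rewrite ler_wpM2l // mulr_ge0 // expR_ge0.
rewrite sum_split_ffun; apply: (le_trans (ler_sum _ (fun g _ => bound g))).
rewrite -mulr_sumr.
apply: (@le_trans _ _ (2%:R * expR al * ((2 ^ d)%:R * expR (2%:R * \sum_i B i i)))).
  by rewrite ler_wpM2l ?mulr_ge0 ?expR_ge0 ?ler0n // IH.
have -> : 2%:R * expR al * ((2 ^ d)%:R * expR (2%:R * \sum_i B i i)) =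
  (2 ^ d.+1)%:R * (expR al * expR (2%:R * \sum_i B i i)) by rewrite expnS natrM; ring.
rewrite ler_wpM2l ?ler0n // -expRD ler_expR big_ord_recl trB -/al.
(* The rank one term contributes 16 [na] <= [al] to the exponent, so [al] grows at most to the
   available 2 [al]. *)
have : \sum_i A' i i = \sum_(i < d) A (lift ord0 i) (lift ord0 i) by [].
move=> <-; lra.
Qed.

End RandomSubspaces.

(** * Identification codes from random subspaces *)

Section QuantumCodes.
Context {R : realType}.
Local Notation C := R[i].

(** Gram-Schmidt: the part w of a new vector orthogonal to the range of P contributes the projector
    w w^T / |w|^2, and nothing if w = 0. *)
Lemma ortho_projector d (us : seq 'cV[R]_d) : exists P : 'M[R]_d,
  [/\ P^T = P, P *m P = P, {in us, forall u, P *m u = u} & \tr P <= (size us)%:R].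
Proof.
elim: us => [|u us [P [PT PP Pus trP]]].
  by exists 0; split; rewrite ?trmx0 ?mulmx0 ?mxtrace0.
pose w := u - P *m u.
have [w0|w0] := eqVneq w 0.
  exists P; split => // [x|]; last by apply: le_trans trP _; rewrite ler_nat.
  by rewrite inE => /predU1P[->|/Pus //]; apply/esym/eqP; rewrite -subr_eq0 -/w w0.
have Pw : P *m w = 0 by rewrite mulmxBr mulmxA PP subrr.
have wP : w^T *m P = 0 by rewrite -PT -trmx_mul Pw trmx0.
pose c := (w^T *m w) 0 0.
have wwE : w^T *m w = c%:M by rewrite [LHS]mx11_scalar.
have c0 : c != 0.
  apply: contraNneq w0 => c0; apply/eqP/colP => i; rewrite [RHS]mxE.
  have /eqP : \sum_j w j 0 ^+ 2 = 0.
    by rewrite -[RHS]c0 /c mxE; apply: eq_bigr => j _; rewrite !mxE expr2.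
  rewrite psumr_eq0 => [/allP h|j _]; last exact: sqr_ge0.
  by have := h i (mem_index_enum i); rewrite sqrf_eq0 => /eqP.
exists (P + c^-1 *: (w *m w^T)); split.
- by rewrite linearD linearZ /= trmx_mul trmxK PT.
- rewrite mulmxDl !mulmxDr PP -!scalemxAr -!scalemxAl mulmxA Pw mul0mx scaler0 addr0.
  rewrite -mulmxA wP mulmx0 scaler0 add0r; congr (_ + _).
  rewrite mulmxA -[w *m w^T *m w]mulmxA wwE mul_mx_scalar -scalemxAl !scalerA mulfVK //.
- move=> x; rewrite inE mulmxDl -scalemxAl -mulmxA => /predU1P[->|xus].
    have -> : w^T *m u = c%:M.
      by rewrite -[u](subrK (P *m u)) -/w mulmxDr mulmxA wP mul0mx addr0 wwE.
    by rewrite mul_mx_scalar scalerA mulVf // scale1r addrC subrK.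
  by rewrite -[in w^T *m x](Pus x xus) (mulmxA w^T) wP mul0mx mulmx0 scaler0 addr0 Pus.
rewrite linearD linearZ /= mxtrace_mulC wwE mxtrace_scalar mulVf // -natr1.
by rewrite lerD2r.
Qed.

Definition signcol d (g : {ffun 'I_d -> bool}) : 'cV[R]_d := \col_i sgn g i.

Lemma qformE d (M : 'M[R]_d) (v : 'I_d -> R) :
  qform (fun i j => M i j) v = ((\col_i v i)^T *m M *m \col_i v i) 0 0.
Proof.
rewrite /qform exchange_big [RHS]mxE /=; apply: eq_bigr => j _; rewrite !mxE mulr_suml.
by apply: eq_bigr => i _; rewrite !mxE; ring.
Qed.

(** The form is |P v|^2, and |v|^2 - |P v|^2 = |v - P v|^2. *)
Lemma qform_projector d (P : 'M[R]_d) (v : 'I_d -> R) : P^T = P -> P *m P = P ->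
  0 <= qform (fun i j => P i j) v <= \sum_i v i ^+ 2.
Proof.
move=> PT PP; set x : 'cV[R]_d := \col_i v i.
have sq (y : 'cV[R]_d) : 0 <= (y^T *m y) 0 0.
  by rewrite mxE; apply: sumr_ge0 => i _; rewrite mxE -expr2 sqr_ge0.
have -> : \sum_i v i ^+ 2 = (x^T *m x) 0 0.
  by rewrite mxE; apply: eq_bigr => i _; rewrite !mxE expr2.
have e1 : (P *m x)^T = x^T *m P by rewrite trmx_mul PT.
have e2 : (x - P *m x)^T = x^T - x^T *m P by rewrite -e1 linearB.
have := sq (P *m x); have := sq (x - P *m x).
rewrite qformE -/x e1 e2 mulmxA -[x^T *m P *m P]mulmxA PP => h1 h2.
rewrite h2 /=; move: h1.
rewrite mulmxBl !mulmxBr !mulmxA -[x^T *m P *m P]mulmxA PP subrr subr0.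
by rewrite mxE [X in _ + X]mxE subr_ge0.
Qed.

(** Exponential Markov inequality. By [sum_expR_qform] for P / 16, each of the m independent columns
    has exponential moment at most exp (m / 8), together exp (8 h), whereas the exponent on the
    counted set is at least 4 m^2 / 16 = 16 h. Finally e >= 2. *)
Lemma card_large_projection d m h (P : 'M[R]_d) (l : R) :
  P^T = P -> P *m P = P -> \tr P <= m%:R -> (m * m = 64 * h)%N -> 4%:R * m%:R <= l * d%:R ->
  (#|[set G : {ffun 'I_m -> {ffun 'I_d -> bool}} |
       (l * d%:R * m%:R < \sum_k qform (fun i j => P i j) (sgn (G k)))%R]|
     * 2 ^ (8 * h) <= 2 ^ (d * m))%N.
Proof.
move=> PT PP trP mh ml; set bad := [set _ | _].
pose A i j := 16%:R^-1 * P i j.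
have qA v : qform A v = 16%:R^-1 * qform (fun i j => P i j) v.
  rewrite mulr_sumr; apply: eq_bigr => i _; rewrite mulr_sumr; apply: eq_bigr => j _.
  by rewrite [RHS]mulrA.
have hA : \sum_(g : {ffun 'I_d -> bool}) expR (qform A (sgn g)) <=
    (2 ^ d)%:R * expR (m%:R / 8%:R).
  apply: le_trans (sum_expR_qform _ _) _.
  - by move=> i j; rewrite /A -{1}PT mxE.
  - move=> v; have /andP[h0 h1] := qform_projector v PT PP.
    by rewrite qA mulr_ge0 ?invr_ge0 ?ler0n // ler_wpM2l // invr_ge0 ler0n.
  rewrite ler_wpM2l ?ler0n // ler_expR -mulr_sumr.
  move: trP; rewrite /mxtrace => trP; lra.
have sumG : \sum_(G : {ffun 'I_m -> {ffun 'I_d -> bool}}) expR (\sum_k qform A (sgn (G k))) =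
    (\sum_(g : {ffun 'I_d -> bool}) expR (qform A (sgn g))) ^+ m.
  rewrite -[in RHS](card_ord m) -prodr_const bigA_distr_bigA /=.
  by apply: eq_bigr => G _; rewrite expR_sum.
have e64 : m%:R * m%:R = 64%:R * h%:R :> R by rewrite -!natrM mh.
have h1 : #|bad|%:R * expR (16%:R * h%:R) <= (2 ^ (d * m))%:R * expR (8%:R * h%:R) :> R.
  have -> : (2 ^ (d * m))%:R * expR (8%:R * h%:R) = ((2 ^ d)%:R * expR (m%:R / 8%:R)) ^+ m :> R.
    rewrite exprMn -natrX -expnM -expRM_natl; congr (_ * expR _).
    by rewrite mulrA e64; field.
  apply: (@le_trans _ _ ((\sum_(g : {ffun 'I_d -> bool}) expR (qform A (sgn g))) ^+ m)).
    rewrite -sumG (bigID (mem bad)) /= mulr_natl -sumr_const.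
    rewrite -[leLHS]addr0 lerD //; last by apply: sumr_ge0 => G _; exact: expR_ge0.
    apply: ler_sum => G; rewrite inE => /ltW hG; rewrite ler_expR.
    rewrite (eq_bigr (fun k => 16%:R^-1 * qform (fun i j => P i j) (sgn (G k)))) => [|k _ //].
    rewrite -mulr_sumr [leRHS]mulrC ler_pdivlMr ?ltr0n //.
    apply: le_trans hG; have : 0 <= m%:R :> R by exact: ler0n.
    move=> m0; have := ler_wpM2r m0 ml; rewrite -(mulrA 4%:R) e64; lra.
  by rewrite lerXn2r ?nnegrE ?mulr_ge0 ?ler0n ?expR_ge0 // sumr_ge0 // => g _; exact: expR_ge0.
have h2 : #|bad|%:R * expR (8%:R * h%:R) <= (2 ^ (d * m))%:R :> R.
  rewrite -(@ler_pM2r _ (expR (8%:R * h%:R))) ?expR_gt0 // -mulrA -expRD.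
  by have -> : 8%:R * h%:R + 8%:R * h%:R = 16%:R * h%:R :> R by ring.
rewrite -(@ler_nat R) natrM; apply: le_trans h2; rewrite ler_wpM2l ?ler0n //.
rewrite -natrM -[X in expR X]mulr1 expRM_natl natrX lerXn2r ?nnegrE ?ler0n ?expR_ge0 //.
by have := expR_ge1Dx (1 : R).
Qed.

Lemma adjmx_map m n (A : 'M[R]_(m, n)) :
  adjmx (map_mx (real_complex R) A) = map_mx (real_complex R) A^T.
Proof. by apply/matrixP => i j; rewrite !mxE; apply/CrealP/complex_realP; exists (A j i). Qed.

Lemma psdmx_map_projector d (P : 'M[R]_d) : P^T = P -> P *m P = P ->
  psdmx (map_mx (real_complex R) P).
Proof.
move=> PT PP; have := psdmx_congr (map_mx (real_complex R) P) (@psdmx1 R d).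
by rewrite mulmx1 adjmx_map PT -map_mxM PP.
Qed.

(** A d by m sign matrix G, with m = 2^(n-s), gives the state G G^T / (d m) and a projector of trace
    at most m that fixes its columns, hence accepts with certainty. The relation [bad x y] says that
    the projector of x accepts the state of y too often; for fixed x few y do this. The 3 in s + 3
    comes from m^2 = 64 h and 64 = 4^3. *)
Lemma id_code_exists (l : R) s n : 4%:R <= l * (2 ^ s)%:R -> (s + 3 <= n)%N ->
  exists (rho D : 'I_(2 ^ (4 ^ (n - (s + 3)))) -> 'M[C]_(2 ^ n)),
    id_code (ntensmap (idchan R 2) (n := n)) l l rho D.
Proof.
move=> ls sn; set h := (4 ^ (n - (s + 3)))%N.
pose d := (2 ^ n)%N; pose m := (2 ^ (n - s))%N.
have d0 : (0 < d)%N by rewrite expn_gt0.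
have m0 : (0 < m)%N by rewrite expn_gt0.
have h0 : (0 < h)%N by rewrite expn_gt0.
have mh : (m * m = 64 * h)%N.
  rewrite /m /h -expnD -[64%N]/(2 ^ 6)%N -[4%N]/(2 ^ 2)%N -expnM -expnD.
  by congr (2 ^ _)%N; lia.
have dm : d = (2 ^ s * m)%N by rewrite /d /m -expnD; congr (2 ^ _)%N; lia.
have md : (m <= d)%N by rewrite dm leq_pmull // expn_gt0.
have ml : 4%:R * m%:R <= l * d%:R by rewrite dm natrM mulrA ler_wpM2r ?ler0n.
have hdm : (8 * h <= d * m)%N.
  by apply: (@leq_trans (m * m)); [rewrite mh leq_mul2r orbT|rewrite leq_mul2r md orbT].
pose T : finType := {ffun 'I_m -> {ffun 'I_d -> bool}}.
have [P hP] := fin_all_exists (fun x : T => ortho_projector [seq signcol (x k) | k : 'I_m]).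
have PT x : (P x)^T = P x by case: (hP x).
have PP x : P x *m P x = P x by case: (hP x).
have Pcol x k : P x *m signcol (x k) = signcol (x k).
  by case: (hP x) => _ _ h1 _; apply: h1; apply/mapP; exists k; rewrite // mem_enum.
have trP x : \tr (P x) <= m%:R.
  by case: (hP x) => _ _ _; rewrite size_map -cardE card_ord.
pose q (x y : T) := \sum_k qform (fun i j => P x i j) (sgn (y k)).
pose bad (x y : T) := l * d%:R * m%:R < q x y.
have hbad x : (#|[set y | bad x y]| <= 2 ^ (d * m - 8 * h))%N.
  rewrite -(@leq_pmul2r (2 ^ (8 * h))) ?expn_gt0 // -expnD subnK //.
  exact: card_large_projection.
have [|f hf] := digraph_independent (k := (2 ^ h)%N) hbad.
  rewrite !card_ffun card_bool !card_ord -expnM.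
  have e1 : ((2 * 2 ^ (d * m - 8 * h)).+1 <= 2 ^ (d * m - 8 * h + 2))%N.
    by rewrite expnD -[X in (_ <= _ * X)%N]/4%N; have := expn_gt0 2 (d * m - 8 * h); lia.
  apply: leq_trans (leq_mul (leqnn _) e1) _; rewrite -expnD leq_exp2l //; lia.
pose c_ := real_complex R.
have dmR : (d * m)%:R != 0 :> R by rewrite pnatr_eq0 -lt0n muln_gt0 d0.
pose rho (x : T) : 'M[C]_d :=
  map_mx c_ ((d * m)%:R^-1 *: \sum_k signcol (x k) *m (signcol (x k))^T).
have trrho x M : \tr (rho x *m map_mx c_ M) =
    c_ ((d * m)%:R^-1 * \sum_k qform (fun i j => M i j) (sgn (x k))).
  rewrite -map_mxM trace_map_mx -scalemxAl mxtraceZ mulmx_suml raddf_sum /=.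
  congr (c_ (_ * _)); apply: eq_bigr => k _.
  by rewrite qformE -[X in \tr X]mulmxA mxtrace_mulC /mxtrace big_ord1.
have qd (x : T) k : qform (fun i j => (1%:M : 'M[R]_d) i j) (sgn (x k)) = d%:R.
  rewrite qformE mulmx1 mxE -[X in _ = X%:R]card_ord -sumr_const; apply: eq_bigr => i _.
  by rewrite !mxE /sgn -expr2 sqrr_sign.
have one : (d * m)%:R^-1 * \sum_(k < m) d%:R = 1 :> R.
  by rewrite sumr_const card_ord -mulrnA mulVf.
have qPx x k : qform (fun i j => P x i j) (sgn (x k)) = d%:R.
  rewrite -(qd x k) !qformE mulmx1 -mulmxA; congr (_ 0 0); congr (_ *m _).
  exact: Pcol.
exists (fun i => rho (f i)), (fun i => map_mx c_ (P (f i))); split.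
- move=> i; split.
    rewrite /rho map_mxZ map_mx_sum; apply: psdmxZ.
      by rewrite -[0]/(c_ 0) lecR invr_ge0 ler0n.
    apply: psdmx_sum => k _; rewrite map_mxM -adjmx_map.
    have := psdmx_congr (adjmx (map_mx c_ (signcol (f i k)))) (@psdmx1 R 1).
    by rewrite mulmx1 adjmxK.
  rewrite -[rho _]mulmx1 -(map_mx1 c_) trrho.
  by rewrite (eq_bigr (fun=> d%:R)) ?one // => k _; exact: qd.
- move=> i; split; first exact: psdmx_map_projector.
  rewrite -(map_mx1 c_) -map_mxB; apply: psdmx_map_projector.
    by rewrite linearB /= trmx1 PT.
  by rewrite mulmxBl !mulmxBr !mul1mx !mulmx1 PP subrr subr0.
- move=> i; rewrite ntensmap_idchan trrho lecR (eq_bigr _ (fun k _ => qPx (f i) k)) one.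
  have l0 : 0 <= l.
    by rewrite -(@pmulr_lge0 _ (2 ^ s)%:R) ?ltr0n ?expn_gt0 //; apply: le_trans ls; exact: ler0n.
  by rewrite gerBl.
- move=> i j ij; rewrite ntensmap_idchan trrho lecR.
  rewrite mulrC ler_pdivrMr ?ltr0n ?muln_gt0 ?d0 // natrM mulrA leNgt.
  by have := hf j i; rewrite eq_sym; apply.
Qed.

End QuantumCodes.

(** * Upper bound by discretising the states *)

Section PigeonholeBound.
Context {R : realType}.
Local Notation C := R[i].

Lemma norm_Re_le (z : C) : (`|complex.Re z|)%:C%C <= `|z|.
Proof. by rewrite normc_def lecR -sqrtr_sqr ler_wsqrtr // lerDl sqr_ge0. Qed.

Lemma norm_Im_le (z : C) : (`|complex.Im z|)%:C%C <= `|z|.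
Proof. by rewrite normc_def lecR -sqrtr_sqr ler_wsqrtr // lerDr sqr_ge0. Qed.

Lemma norm_le_ReIm (z : C) : `|z| <= (`|complex.Re z| + `|complex.Im z|)%:C%C.
Proof.
rewrite normc_def lecR -[leRHS]ger0_norm ?addr_ge0 // -sqrtr_sqr ler_wsqrtr //.
by rewrite sqrrD !real_normK ?num_real // addrAC lerDl mulrn_wge0 //.
Qed.

Lemma psdmx_entry_le n (M : 'M[C]_n) i j : psdmx M -> `|M i j| <= \tr M.
Proof.
move=> hM; have dg k : M k k <= \tr M.
  by rewrite /mxtrace (bigD1 k) //= lerDl; apply: sumr_ge0 => l _; exact: psdmx_diag_ge0.
have [->|x0] := eqVneq (M i j) 0; first by rewrite normr0 psdmx_tr_ge0.
have n0 : `|M i j| != 0 by rewrite normr_eq0.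
(* The phase that turns M_ij into -|M_ij|; the form at e_i + c e_j is then M_ii + M_jj - 2
   |M_ij|. *)
set c := - (M i j)^*%R / `|M i j|.
have Mji : M j i = (M i j)^*%R by rewrite -{1}(psdmx_herm hM) adjmxE.
have c1 : c * M i j = - `|M i j|.
  by rewrite /c mulrAC mulNr mulrC -[X in _ * - X]mulrC mulrN -normCK expr2 mulKf.
have c2 : c^*%R * M j i = - `|M i j|.
  by rewrite Mji -rmorphM c1 rmorphN /= conj_Creal // normr_real.
have c3 : `|c| = 1 by rewrite /c normrM normrN norm_conjC normfV normr_id divff.
have := hM (delta_mx i 0 + c *: delta_mx j 0).
rewrite form_delta2 c1 c2 c3 expr1n mul1r => h.
rewrite -(@ler_pM2l C 2%:R) ?ltr0n // !mulr_natl !mulr2n.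
apply: le_trans (lerD (dg i) (dg j)); rewrite -subr_ge0; apply: le_trans h _.
by rewrite le_eqVlt; apply/orP; left; apply/eqP; ring.
Qed.

(** [Num.truncn] is the floor only on nonnegative reals, hence the shift by 1. *)
Lemma truncn_eq_dist (q : nat) (x y : R) : (0 < q)%N -> -1 <= x -> -1 <= y ->
  Num.truncn (q%:R * (x + 1)) = Num.truncn (q%:R * (y + 1)) -> `|x - y| <= q%:R^-1.
Proof.
move=> q0 hx hy e; have qR : 0 < q%:R :> R by rewrite ltr0n.
have x0 : 0 <= q%:R * (x + 1) by rewrite mulr_ge0 ?ler0n //; lra.
have y0 : 0 <= q%:R * (y + 1) by rewrite mulr_ge0 ?ler0n //; lra.
have /andP[x1 x2] := truncn_itv x0; have /andP[y1 y2] := truncn_itv y0.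
rewrite e in x1 x2; rewrite -natr1 in x2 y2.
rewrite -[leRHS]mul1r ler_pdivlMr // -[X in _ * X]gtr0_norm // -normrM ler_norml.
apply/andP; split; lra.
Qed.

(** Each real and imaginary part is rounded to one of 2 q + 1 cells of width 1 / q. States with
    equal cells differ by at most 2 / q per entry, so an effect accepts them with probabilities at
    most 2 d^3 / q = 1/4 apart, less than the gap 1/2 required of the code. *)
Lemma id_code_size_le d N (rho D : 'I_N -> 'M[C]_d) : (0 < d)%N ->
  id_code id (4%:R^-1 : R) 4%:R^-1 rho D ->
  (N <= (2 * (8 * d ^ 3) + 1) ^ (2 * (d * d)))%N.
Proof.
move=> d0 [hrho hD h1 h2]; set q := (8 * d ^ 3)%N.
have q0 : (0 < q)%N by rewrite muln_gt0 expn_gt0 d0.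
have qR : 0 < q%:R :> R by rewrite ltr0n.
have rho1 i a b : `|rho i a b| <= 1 by have [r0 <-] := hrho i; exact: psdmx_entry_le.
have Dd i a b : `|D i a b| <= d%:R.
  have [D0 D1] := hD i; apply: le_trans (psdmx_entry_le _ _ D0) _.
  by have := psdmx_tr_ge0 D1; rewrite raddfB /= mxtrace1 subr_ge0.
have Re1 i a b : `|complex.Re (rho i a b)| <= 1.
  by have := le_trans (norm_Re_le _) (rho1 i a b); rewrite -[1]/((1 : R)%:C%C) lecR.
have Im1 i a b : `|complex.Im (rho i a b)| <= 1.
  by have := le_trans (norm_Im_le _) (rho1 i a b); rewrite -[1]/((1 : R)%:C%C) lecR.
pose cell (x : R) : 'I_(2 * q).+1 := inord (Num.truncn (q%:R * (x + 1))).
have cellE x y : `|x| <= 1 -> `|y| <= 1 -> cell x = cell y -> `|x - y| <= q%:R^-1.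
  rewrite !(ler_norml _ 1) => /andP[x1 x2] /andP[y1 y2] e; refine (truncn_eq_dist q0 x1 y1 _).
  have lt (z : R) : -1 <= z -> z <= 1 -> (Num.truncn (q%:R * (z + 1)) < (2 * q).+1)%N.
    move=> z1 z2; rewrite ltnS -(@ler_nat R).
    have z0 : 0 <= q%:R * (z + 1) by rewrite mulr_ge0 ?ler0n //; lra.
    have /andP[h _] := truncn_itv z0; apply: le_trans h _.
    by rewrite mulnC natrM ler_wpM2l ?ler0n //; lra.
  by have := congr1 val e; rewrite /= !inordK ?lt.
pose F i : {ffun 'I_d * 'I_d -> 'I_(2 * q).+1 * 'I_(2 * q).+1} :=
  [ffun p => (cell (complex.Re (rho i p.1 p.2)), cell (complex.Im (rho i p.1 p.2)))].
have Finj : injective F.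
  move=> i j Fij; apply/eqP/negP => /negP ij.
  have close a b : `|rho i a b - rho j a b| <= 2%:R / q%:R.
    have := congr1 (fun f : {ffun _ -> _} => f (a, b)) Fij; rewrite !ffunE /= => -[e1 e2].
    have b1 := cellE _ _ (Re1 i a b) (Re1 j a b) e1.
    have b2 := cellE _ _ (Im1 i a b) (Im1 j a b) e2.
    apply: le_trans (norm_le_ReIm _) _.
    have -> : (2%:R / q%:R = (q%:R^-1 + q%:R^-1 : R)%:C%C :> C).
      by rewrite [RHS]rmorphD /= fmorphV rmorph_nat mulr_natl mulr2n.
    rewrite lecR; apply: lerD.
      by move: b1; case: (rho i a b) (rho j a b) => [? ?] [? ?].
    by move: b2; case: (rho i a b) (rho j a b) => [? ?] [? ?].
  have h3 : `|\tr (rho i *m D i) - \tr (rho j *m D i)| <= 4%:R^-1 :> C.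
    rewrite -raddfB -mulmxBl /mxtrace; apply: le_trans (ler_norm_sum _ _ _) _.
    have bnd a : `|((rho i - rho j) *m D i) a a| <= d%:R * (2%:R / q%:R * d%:R).
      rewrite mxE; apply: le_trans (ler_norm_sum _ _ _) _.
      rewrite [leRHS]mulr_natl -[X in _ *+ X]card_ord -sumr_const.
      apply: ler_sum => b _; rewrite normrM; apply: ler_pM => //.
      by rewrite !mxE.
    apply: (le_trans (ler_sum _ (fun a _ => bnd a))).
    rewrite sumr_const card_ord -[leLHS]mulr_natl.
    have dC : d%:R != 0 :> C by rewrite pnatr_eq0 -lt0n.
    rewrite le_eqVlt; apply/orP; left; apply/eqP; rewrite /q !natrM; field.
    exact: dC.
  have h4 := h1 i; have h5 := h2 j i; rewrite eq_sym in h5; have {}h5 := h5 ij.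
  have h6 := le_trans (lerB h4 h5) (real_ler_norm _).
  have : ((1 - 4%:R^-1)%:C - (4%:R^-1)%:C <= 4%:R^-1 :> C)%C.
    by apply: le_trans h3; apply: h6; rewrite rpredB // ger0_real //;
      apply: psdmx_tr_mul_ge0; [case: (hrho i)|case: (hD i)|case: (hrho j)|case: (hD i)].
  have -> : (4%:R^-1 = (4%:R^-1 : R)%:C%C :> C) by rewrite fmorphV rmorph_nat.
  rewrite -rmorphB lecR; lra.
have := leq_card F Finj; rewrite !card_ffun card_prod !card_ord card_prod !card_ord.
by rewrite mulnn -expnM addn1.
Qed.

Lemma id_code_size_qubit n N (rho D : 'I_N -> 'M[C]_(2 ^ n)) : (3 < n)%N ->
  id_code (ntensmap (idchan R 2) (n := n)) (4%:R^-1 : R) 4%:R^-1 rho D ->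
  (N <= 2 ^ (4 ^ n * n ^ 3))%N.
Proof.
move=> n3 [h1 h2 h3 h4].
have hc : id_code id (4%:R^-1 : R) 4%:R^-1 rho D.
  split => // [i|i j ij]; first by have := h3 i; rewrite ntensmap_idchan.
  by have := h4 i j ij; rewrite ntensmap_idchan.
have d0 : (0 < 2 ^ n)%N by rewrite expn_gt0.
apply: leq_trans (id_code_size_le d0 hc) _.
have b : (2 * (8 * (2 ^ n) ^ 3) + 1 <= 2 ^ (3 * n + 5))%N.
  have -> : (2 ^ (3 * n + 5) = 32 * (2 ^ n) ^ 3)%N by rewrite expnD -expnM mulnC [(n * 3)%N]mulnC.
  have : (0 < (2 ^ n) ^ 3)%N by rewrite !expn_gt0.
  by move: ((2 ^ n) ^ 3)%N => x; lia.
apply: (@leq_trans ((2 ^ (3 * n + 5)) ^ (2 * (2 ^ n * 2 ^ n)))%N).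
  by rewrite leq_exp2r // muln_gt0 /= -expnD expn_gt0.
rewrite -expnM leq_exp2l // -expnD addnn -mul2n expnM -[(2 ^ 2)%N]/4%N.
rewrite [X in (X <= _)%N]mulnA mulnC leq_mul2l; apply/orP; right.
(* What remains is 2 (3 n + 5) <= n^3, true from n = 4 on but false at n = 3. *)
by rewrite !expnS expn0 muln1; nia.
Qed.

End PigeonholeBound.

(** * Rates *)

Section Rates.
Context {R : realType}.
Local Open Scope classical_set_scope.
Local Open Scope ereal_scope.

Lemma ln2_gt0 : (0 < ln 2 :> R)%R.
Proof. by rewrite ln_gt0 // ltr1n. Qed.

Lemma le_log2 (x y : \bar R) : x <= y -> log2 x <= log2 y.
Proof.
move=> xy; rewrite /log2 lee_pmul2r ?lte_fin ?invr_gt0 ?ln2_gt0 //.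
case: (leP 0 x) => x0; last by rewrite (le0_lneNy (ltW x0)) leNye.
by rewrite lee_lne // in_itv /= leey andbT // (le_trans x0).
Qed.

Lemma log2_EFin (x : R) : (0 < x)%R -> log2 x%:E = (ln x / ln 2)%:E.
Proof. by move=> x0; rewrite /log2 lne_EFin. Qed.

Lemma log2_expn m : log2 ((2 ^ m)%:R : R)%:E = (m%:R)%:E.
Proof.
rewrite log2_EFin ?ltr0n ?expn_gt0 // natrX lnXn ?ltr0n // -[(ln _ *+ m)%R]mulr_natl mulfK //.
by rewrite gt_eqF ?ln2_gt0.
Qed.

Lemma limn_esup_le_fin (u : nat -> \bar R) (l : R) :
  (forall e : R, (0 < e)%R -> exists n0, forall n, (n0 <= n)%N -> u n <= (l + e)%:E) ->
  limn_esup u <= l%:E.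
Proof.
move=> h; apply/lee_addgt0Pr => e e0; have [n0 hn0] := h e e0.
rewrite /limn_esup /limf_esup; apply: (@le_trans _ _ (ereal_sup (u @` [set n | (n0 <= n)%N]))).
  by apply: ereal_inf_lbound; exists [set n | (n0 <= n)%N] => //; exists n0.
by apply: ge_ereal_sup => _ [n /= hn <-]; rewrite -EFinD; exact: hn0.
Qed.

Lemma limn_einf_ge_fin (u : nat -> \bar R) (l : R) :
  (forall e : R, (0 < e)%R -> exists n0, forall n, (n0 <= n)%N -> (l - e)%:E <= u n) ->
  l%:E <= limn_einf u.
Proof.
move=> h; rewrite /limn_einf leeNr -EFinN; apply: limn_esup_le_fin => e e0.
have [n0 hn0] := h e e0; exists n0 => n hn /=.
by rewrite leeNl -EFinN opprD opprK; exact: hn0.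
Qed.

(** The double logarithm of 2^(c^n n^3) is n log c + 3 log n. From ln n <= dl n - ln dl with dl = e
    ln 2 / 6, the term dl n uses half of the allowed e n, and for large n the constant fits into the
    other half. *)
Lemma limn_esup_rate_le (N : nat -> \bar R) (c : nat) n0 : (0 < c)%N ->
  (forall n, (n0 <= n)%N -> N n <= ((2 ^ (c ^ n * n ^ 3))%:R)%:E) ->
  limn_esup (loglog_rate N) <= log2 (c%:R)%:E.
Proof.
move=> c0 hN; rewrite log2_EFin ?ltr0n //; apply: limn_esup_le_fin => e e0.
have ln2 := ln2_gt0; pose dl : R := (e * ln 2 / 6%:R)%R.
have dl0 : (0 < dl)%R by rewrite !mulr_gt0 ?ln2_gt0 ?invr_gt0 ?ltr0n.
exists (maxn n0 (Num.truncn (6%:R * `|ln dl| / (e * ln 2))%R).+1) => n.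
rewrite geq_max => /andP[nn0 nt].
have n_gt0 : (0 < n)%N by apply: leq_trans nt.
have nR : (0 < n%:R :> R)%R by rewrite ltr0n.
have cR : (0 < c%:R :> R)%R by rewrite ltr0n.
apply: (@le_trans _ _ ((n%:R^-1)%:E * log2 (log2 ((2 ^ (c ^ n * n ^ 3))%:R)%:E))).
  by rewrite /loglog_rate lee_pmul2l ?lte_fin ?invr_gt0 //; do 2!apply: le_log2; exact: hN.
rewrite log2_expn log2_EFin ?ltr0n ?muln_gt0 ?expn_gt0 ?c0 ?n_gt0 // -EFinM lee_fin.
rewrite natrM !natrX lnM ?posrE ?exprn_gt0 // !lnXn //.
have lnn : (ln n%:R <= dl * n%:R - ln dl :> R)%R.
  rewrite lerBrDr -lnM ?posrE // [(n%:R * dl)%R]mulrC ltW //.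
  by apply: ln_sublinear; rewrite mulr_gt0.
have h1 : (6%:R * `|ln dl| <= e * ln 2 * n%:R :> R)%R.
  rewrite [leRHS]mulrC -ler_pdivrMr ?mulr_gt0 //; apply/ltW.
  by apply: lt_le_trans (truncnS_gt _) _; rewrite ler_nat.
have h2 := ler_norm (- ln dl)%R; rewrite normrN in h2.
have h3 : (dl * n%:R = e * ln 2 * n%:R / 6%:R :> R)%R by rewrite /dl; ring.
have -> : (n%:R^-1 * ((ln c%:R *+ n + ln n%:R *+ 3) / ln 2) =
    ln c%:R / ln 2 + 3%:R * ln n%:R / (ln 2 * n%:R) :> R)%R.
  rewrite -(mulr_natr _ n) -(mulr_natr _ 3); field.
  by rewrite !gt_eqF.
rewrite lerD2l ler_pdivrMr ?mulr_gt0 // mulrA.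
lra.
Qed.

(** The double logarithm of the lower bound is (n - s) log c, so the rate loses only s log c / n. *)
Lemma limn_einf_rate_ge (N : nat -> \bar R) (c s : nat) n0 : (0 < c)%N ->
  (forall n, (n0 <= n)%N -> ((2 ^ (c ^ (n - s)))%:R)%:E <= N n) ->
  log2 (c%:R)%:E <= limn_einf (loglog_rate N).
Proof.
move=> c0 hN; rewrite log2_EFin ?ltr0n //; apply: limn_einf_ge_fin => e e0.
have cR : (0 < c%:R :> R)%R by rewrite ltr0n.
have ln2 := ln2_gt0; have L0 : (0 <= ln c%:R / ln 2 :> R)%R.
  by rewrite divr_ge0 ?ln_ge0 ?ler1n // ltW.
set L := (ln c%:R / ln 2)%R in L0 *.
exists (maxn (maxn n0 s) (Num.truncn (s%:R * L / e)%R).+1) => n.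
rewrite !geq_max => /andP[/andP[nn0 ns] nt].
have n_gt0 : (0 < n)%N by apply: leq_trans nt.
have nR : (0 < n%:R :> R)%R by rewrite ltr0n.
apply: (@le_trans _ _ ((n%:R^-1)%:E * log2 (log2 ((2 ^ (c ^ (n - s)))%:R)%:E))); last first.
  by rewrite /loglog_rate lee_pmul2l ?lte_fin ?invr_gt0 //; do 2!apply: le_log2; exact: hN.
rewrite log2_expn log2_EFin ?ltr0n ?expn_gt0 ?c0 // -EFinM lee_fin.
rewrite natrX lnXn // -[(ln c%:R *+ _)%R]mulr_natr mulrAC -/L natrB //.
rewrite mulrC ler_pdivlMr // mulrBl mulrBr lerD2l lerN2 mulrC.
rewrite [(e * _)%R]mulrC -ler_pdivrMr //; apply/ltW.
by apply: lt_le_trans (truncnS_gt _) _; rewrite ler_nat.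
Qed.

Lemma largest_size_le (P : nat -> Prop) (M : nat) : (forall N, P N -> (N <= M)%N) ->
  largest_size P <= (M%:R : R)%:E.
Proof.
move=> h; apply: ge_ereal_sup => _ [N /= PN <-].
by rewrite lee_fin ler_nat; exact: h.
Qed.

Lemma largest_size_ge (P : nat -> Prop) (M : nat) : P M -> (M%:R : R)%:E <= largest_size P.
Proof. by move=> PM; apply: ereal_sup_ubound; exists M. Qed.

Lemma ID_sim_strong_converse a b (Phi : {linear 'M[R[i]]_a -> 'M[R[i]]_b}) (l1 l2 : R) :
  (0 < a)%N -> (0 < b)%N -> cptp Phi -> (l1 + l2 < 1)%R ->
  limn_esup (loglog_rate (fun n => ID_sim_size Phi n l1 l2)) <= log2 ((minn a b)%:R)%:E.
Proof.
move=> a0 b0 hPhi hl.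
(* The choice ensures both 2 < g and 12 / g < 1 - l1 - l2, the gap used in
   [simultaneous_code_bound]. *)
pose g := (Num.truncn (12%:R / (1 - l1 - l2))%R).+3.
have g0 : (0 < g%:R :> R)%R by rewrite ltr0n.
have l0 : (0 < 1 - l1 - l2)%R by lra.
have hg : (l2 + 12%:R / g%:R < 1 - l1)%R.
  rewrite -ltrBrDl ltr_pdivrMr // mulrC -ltr_pdivrMr //.
  apply: lt_le_trans (truncnS_gt _) _; rewrite ler_nat /g; exact: leqW.
set c := minn a b; have c0 : (0 < c)%N by rewrite leq_min a0.
apply: (@limn_esup_rate_le _ c (48 * g ^ 2 * c * (48 * g ^ 2 + 3 * c + 3)).+1 c0) => n hn.
apply: largest_size_le => N [rho [D [hc hs]]].
exact/ltnW/(simultaneous_code_lt a0 b0 hPhi _ hg hn hc hs).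
Qed.

Lemma C_ID_sim_le a b (Phi : {linear 'M[R[i]]_a -> 'M[R[i]]_b}) :
  (0 < a)%N -> (0 < b)%N -> cptp Phi -> C_ID_sim Phi <= log2 ((minn a b)%:R : R)%:E.
Proof.
move=> a0 b0 hPhi.
(* The infimum over the error is at most the value at 1/4, where the strong converse applies since
   1/4 + 1/4 < 1. *)
apply: (@le_trans _ _ (limn_einf (loglog_rate (fun n => ID_sim_size Phi n (4%:R^-1 : R) 4%:R^-1)))).
  by apply: ereal_inf_lbound; exists (4%:R^-1)%R => //=; rewrite invr_gt0 ltr0n.
apply: le_trans (limn_einf_sup _) _; apply: ID_sim_strong_converse => //.
lra.
Qed.

Lemma cptp_idfun d : cptp (idfun : {linear 'M[R[i]]_d -> 'M[R[i]]_d}).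
Proof. by split=> [k X hX|//]; rewrite tensmap_id. Qed.

Lemma log2_natr2 : log2 (2%:R : R)%:E = 1.
Proof. by rewrite -[2%N]/(2 ^ 1)%N log2_expn. Qed.

Lemma log2_natr4 : log2 (4%:R : R)%:E = 2%:E.
Proof. by rewrite -[4%N]/(2 ^ 2)%N log2_expn. Qed.

Lemma C_ID_sim_qubit : C_ID_sim (idchan R 2) = 1.
Proof.
apply/eqP; rewrite eq_le; apply/andP; split.
  rewrite -log2_natr2 -[X in X%:R]/(minn 2 2).
  exact: (C_ID_sim_le _ _ (cptp_idfun 2)).
apply: le_ereal_inf_tmp => _ [l /= l0 <-].
pose t := (Num.truncn (l^-1)%R).+1.
have tl : (t%:R^-1 <= l)%R.
  rewrite -[leRHS]invrK lef_pV2 ?posrE ?invr_gt0 ?ltr0n //.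
  by apply/ltW; exact: truncnS_gt.
rewrite -log2_natr2; apply: (@limn_einf_rate_ge _ 2 (2 * t + 1) (2 * t + 2)) => // n hn.
apply: largest_size_ge; apply: id_simultaneous_code_exists => //.
by rewrite -addnS.
Qed.

Lemma C_ID_qubit : C_ID (idchan R 2) = 2%:E.
Proof.
apply/eqP; rewrite eq_le; apply/andP; split.
  apply: (@le_trans _ _
    (limn_einf (loglog_rate (fun n => ID_size (idchan R 2) n (4%:R^-1 : R) 4%:R^-1)))).
    by apply: ereal_inf_lbound; exists (4%:R^-1)%R => //=; rewrite invr_gt0 ltr0n.
  apply: le_trans (limn_einf_sup _) _; rewrite -log2_natr4.
  apply: (@limn_esup_rate_le _ 4 4) => // n hn.
  apply: largest_size_le => N [rho [D hc]].
  exact: (id_code_size_qubit hn hc).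
apply: le_ereal_inf_tmp => _ [l /= l0 <-].
pose s := (Num.truncn (4%:R / l)%R).+1.
have sl : (4%:R <= l * (2 ^ s)%:R)%R.
  rewrite mulrC -ler_pdivrMr //; apply/ltW; apply: lt_le_trans (truncnS_gt _) _.
  by rewrite ler_nat; apply: ltnW; exact: ltn_expl.
rewrite -log2_natr4; apply: (@limn_einf_rate_ge _ 4 (s + 3) (s + 3)) => // n hn.
apply: largest_size_ge.
have [rho [D hc]] := id_code_exists sl hn.
by exists rho, D.
Qed.

End Rates.

Theorem theorem38 (R : realType) :
  (C_ID_sim (idchan R 2) = 1%:E /\
   C_ID (idchan R 2) = 2%:E) /\
  (forall (a b : nat) (Phi : {linear 'M[R[i]]_a -> 'M[R[i]]_b}),
    (0 < a)%N -> (0 < b)%N -> cptp Phi ->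
    (C_ID_sim Phi <= log2 ((minn a b)%:R : R)%:E)%E /\
    (forall l1 l2 : R, 0 < l1 -> 0 < l2 -> l1 + l2 < 1 ->
      (limn_esup (loglog_rate (fun n => ID_sim_size Phi n l1 l2)) <=
       log2 ((minn a b)%:R : R)%:E)%E)).
Proof.
split; first by split; [exact: C_ID_sim_qubit|exact: C_ID_qubit].
move=> a b Phi a0 b0 hPhi; split; first exact: C_ID_sim_le.
by move=> l1 l2 _ _ hl; exact: ID_sim_strong_converse.
Qed.
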